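(* Let $V$ be a finite dimensional graded vector space over a field $\mathbb K$ of characteristic $0$, equipped with a degree $0$, symmetric, non degenerate bilinear form $b$, and let $B(x,y)=(-1)^{\deg(x)}b(x,y)$ be the corresponding symplectic form on $V[1]$. Let $\mathcal D$ be the Lie algebra of multilinear mappings on $V[1]$ with values in $V[1]$, and let $\mathcal D_B\subset\mathcal D$ be the space of $B$-quadratic multilinear mappings. Then: 1. The space $\mathcal D_B$ of $B$-quadratic maps is a Lie subalgebra of $\mathcal D$. 2. The space $\mathcal C(V)$ of cyclic forms on $V[1]$, equipped with the Pinczon bracket associated to $b$, is a graded Lie algebra, isomorphic to $\mathcal D_B$.
   Context: Grading and signs. $|x|$ is the degree of a homogeneous $x\in V$; $V[1]$ is the same space with degree $\deg(x)=|x|-1$. Scalars have degree $0$. Koszul's sign rule is used everywhere: each term in which graded letters appear in an order differing from that of the first term by a permutation $\sigma$ carries the implicit sign of $\sigma$ computed by taking into account only the letters of odd degree (for $\deg$). Multilinear mappings. Any $k$-linear map $Q:V[1]^k\to V[1]$ extends uniquely to a coderivation of the deconcatenation coproduct on $\bigotimes^+V[1]=\sum_{k>0}\bigotimes^kV[1]$, and any coderivation corresponds to a sequence $(Q_k)_{k\ge1}$ of such maps. For $Q$ $k$-linear and $Q'$ $k'$-linear, $$Q\circ Q'(x_1,\ldots,x_{k+k'-1})=\sum_{r=0}^{k-1}Q(x_1,\ldots,x_r,Q'(x_{r+1},\ldots,x_{r+k'}),x_{r+k'+1},\ldots,x_{k+k'-1})$$ and $[Q,Q']=Q\circ Q'-Q'\circ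 Q$, all with Koszul signs. With this bracket the space $\mathcal D$ of multilinear mappings is a graded Lie algebra. Cyclic forms. An $n$-linear form $\Omega$ on $V[1]$ is cyclic if $\Omega(x_n,x_1,\ldots,x_{n-1})=\Omega(x_1,\ldots,x_n)$ (with Koszul sign). $\mathcal C^n$ is the space of $n$-linear cyclic forms, $\mathcal C^0=\mathbb K$, and $\mathcal C(V)$ is the space of all cyclic forms. For an $n$-linear form, $\Omega^{Cycl}=\sum_\tau\Omega^\tau$, the sum over the cyclic subgroup of $\mathfrak S_n$ generated by $(1,2,\ldots,n)$, where $\Omega^\tau(x_1,\ldots,x_n)=\Omega(x_{\tau^{-1}(1)},\ldots,x_{\tau^{-1}(n)})$ (Koszul sign). $B$-quadratic maps. For a $k$-linear map $Q:V[1]^k\to V[1]$, put $\Omega_Q(x_1,\ldots,x_{k+1})=B(Q(x_1,\ldots,x_k),x_{k+1})$; $Q$ is $B$-quadratic if and only if $\Omega_Q$ is cyclic. Pinczon bracket associated to $b$. If $(e_i)$ is a basis of $V$ and $(e'_i)$ the basis with $b(e_i,e'_j)=\delta_{ij}$, then $\{\Omega,\Omega'\}=\sum_i(\iota_{e_i}\Omega\otimes\iota_{e'_i}\Omega')^{Cycl}$, where $\iota_x$ denotes insertion of the vector $x$ in one slot. Signs are normalized by Koszul's rule so that $\sum_i\iota_{e_i}\Omega_Q\otimes\iota_{e'_i}\Omega_{Q'}$ is the form $(x_1,\ldots,x_{k+k'})\mapsto B(Q(x_1,\ldots,x_k),Q'(x_{k+1},\ldots,x_{k+k'}))$.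
   Formalization: As C(V) contains the constants C^0 = K (and C^1), it is not isomorphic to D_B (for V = 0, C(V) = K but D_B = 0); what is proved is that C(V) is a graded Lie algebra and that D_B is isomorphic, by Q -> Omega_Q, to its subalgebra of cyclic forms of arity at least 2. *)

(* Defs.v *)
From HB Require Import structures.
From mathcomp Require Import all_boot all_order all_algebra.
From mathcomp Require Import boolp classical_sets functions.

Set Implicit Arguments.
Unset Strict Implicit.
Unset Printing Implicit Defensive.

Import GRing.Theory.
Local Open Scope classical_set_scope.
Local Open Scope ring_scope.

(** * Graded Lie algebras

    They are carried by a subspace [A] of an ambient vector space [L]; the
    component of degree [d] of [A] is [A `&` deg d]. *)

Section GradedLie.
Variables (K : fieldType) (L : lmodType K).
Implicit Types (A S : set L) (deg : int -> set L) (br : L -> L -> L).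

Definition subspace A : Prop :=
  A 0 /\ forall (a : K) (x y : L), A x -> A y -> A (a *: x + y).

(* [A] is the direct sum of the subspaces [A `&` deg d]. *)
Record graded_subspace A deg : Prop := {
  gsub_subspace : subspace A;
  gsub_component : forall d, subspace (A `&` deg d);
  gsub_span : forall x, A x -> exists (ds : seq int) (c : int -> L),
    (forall d, (A `&` deg d) (c d)) /\ x = \sum_(d <- ds) c d;
  gsub_direct : forall (ds : seq int) (c : int -> L), uniq ds ->
    (forall d, (A `&` deg d) (c d)) -> \sum_(d <- ds) c d = 0 ->
    forall d, d \in ds -> c d = 0
}.

Record graded_Lie_algebra A deg br : Prop := {
  glie_graded : graded_subspace A deg;
  glie_closed : forall x y, A x -> A y -> A (br x y);
  glie_linearl : forall a x y z, A x -> A y -> A z ->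
    br (a *: x + y) z = a *: br x z + br y z;
  glie_linearr : forall a x y z, A x -> A y -> A z ->
    br z (a *: x + y) = a *: br z x + br z y;
  glie_degree : forall d e x y, A x -> A y -> deg d x -> deg e y ->
    deg (d + e) (br x y);
  glie_skew : forall d e x y, A x -> A y -> deg d x -> deg e y ->
    br x y = - ((-1) ^ (d * e) *: br y x);
  glie_jacobi : forall d e x y z, A x -> A y -> A z -> deg d x -> deg e y ->
    br x (br y z) = br (br x y) z + (-1) ^ (d * e) *: br y (br x z)
}.

Record graded_Lie_subalgebra A deg br S : Prop := {
  glsub_ambient : graded_Lie_algebra A deg br;
  glsub_subset : S `<=` A;
  glsub_graded : graded_subspace S deg;
  glsub_closed : forall x y, S x -> S y -> S (br x y)
}.

End GradedLie.

Record graded_Lie_isomorphism (K : fieldType) (L L' : lmodType K)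
    (A : set L) (deg : int -> set L) (br : L -> L -> L)
    (A' : set L') (deg' : int -> set L') (br' : L' -> L' -> L')
    (phi : L -> L') : Prop := {
  gliso_linear : forall a x y, A x -> A y ->
    phi (a *: x + y) = a *: phi x + phi y;
  gliso_bij : set_bij A A' phi;
  gliso_degree : forall d x, A x -> deg d x -> deg' d (phi x);
  gliso_bracket : forall x y, A x -> A y -> phi (br x y) = br' (phi x) (phi y)
}.

(** * Graded vector spaces *)

Record grading (K : fieldType) (V : vectType K) := Grading {
  gr : int -> {vspace V};
  gr_supp : seq int;
  gr_uniq : uniq gr_supp;
  gr_out : forall d, d \notin gr_supp -> gr d = 0%VS;
  gr_direct : directv (\sum_(d <- gr_supp) gr d);
  gr_full : fullv = (\sum_(d <- gr_supp) gr d)%VS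
}.

Section Forms.
Variables (K : fieldType) (V : vectType K) (G : grading V).

(* [x] is homogeneous with deg(x) = |x| - 1 = d, i.e. x is in V[1]_d. *)
Definition sgr (d : int) : {vspace V} := gr G (d + 1).

Definition sgrs (ds : seq int) (s : seq V) : bool :=
  all2 (fun d x => x \in sgr d) ds s.

(* The projection of [V] onto the sum of the V[1]_d with [d] even
   ([p = false]) or odd ([p = true]) along the other ones; the index below is
   |x|, so that deg is [d - 1]. *)
Definition par (p : bool) (x : V) : V :=
  \sum_(d <- gr_supp G | odd `|d - 1|%N == p) sumv_pi_for (gr_full G) d x.

(* The linear map x |-> (-1)^(q deg(x)) x: the Koszul sign for a letter of
   parity [q] jumping over [x]. *)
Definition pass (q : bool) (x : V) : V :=
  par false x + (-1) ^+ q *: par true x.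

Definition pars (p : seq bool) (s : seq V) : seq V :=
  [seq par qx.1 qx.2 | qx <- zip p s].

Definition psum (p : seq bool) : bool := odd (count id p).

(** ** Families of multilinear mappings

    A function [F : seq V -> W] stands for the sequence of its restrictions
    F_k : V^k -> W to the lists of length k.  A [polylinear] function is thus
    a finite sum of k-linear mappings, for various k. *)

Definition polylinear (W : lmodType K) (F : seq V -> W) : Prop :=
  (forall s t (a : K) x y,
     F (s ++ (a *: x + y) :: t) = a *: F (s ++ x :: t) + F (s ++ y :: t))
  /\ exists N : nat, forall s, (N < size s)%N -> F s = 0.

Implicit Types (Q : seq V -> V) (O : seq V -> K^o).

(* The space D of multilinear mappings: k-linear maps with k >= 1. *)
Definition multimaps : set (seq V -> V) :=
  [set Q | polylinear Q /\ Q [::] = 0].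

Definition multimap_degree (d : int) : set (seq V -> V) :=
  [set Q | forall ds s, sgrs ds s -> Q s \in sgr (d + \sum_(e <- ds) e)].

(* Even or odd part of a mapping, for the parity of its degree. *)
Definition mpart (q : bool) Q : seq V -> V := fun s =>
  \sum_(p : (size s).-tuple bool) par (q (+) psum p) (Q (pars p s)).

(* Q o Q' for Q' of parity [q]: Q' jumps over x_1, ..., x_r. *)
Definition mcomp (q : bool) Q Q' : seq V -> V := fun s =>
  \sum_(r < (size s).+1) \sum_(k < (size s - r).+1)
    Q (map (pass q) (take r s) ++ Q' (take k (drop r s)) :: drop (r + k) s).

Definition mbracket Q Q' : seq V -> V :=
  \sum_(p : bool) \sum_(q : bool)
    (mcomp q (mpart p Q) (mpart q Q')
     - (-1) ^+ (p && q) *: mcomp p (mpart q Q') (mpart p Q)).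

(** ** Cyclic forms *)

(* O^tau (x_1, ..., x_n) = O(x_n, x_1, ..., x_(n-1)) with Koszul sign, where
   tau is the cycle (1, 2, ..., n). *)
Definition rotate O : seq V -> K^o := fun s =>
  if s is x :: t then
    \sum_(p : bool) O (par p (last x t) :: map (pass p) (belast x t))
  else O [::].

(* The sum over the cyclic group generated by (1, 2, ..., n), of order
   max(n, 1). *)
Definition Cycl O : seq V -> K^o := fun s =>
  \sum_(j < maxn 1 (size s)) iter j rotate O s.

Definition cyclic_forms : set (seq V -> K^o) :=
  [set O | polylinear O /\ rotate O = O].

(* The forms without components in C^0 and C^1.  A k-linear map yields a form of
   arity k + 1, so these are the forms given by the maps with k >= 1; constants
   are central for the Pinczon bracket and come from no map. *)
Definition cyclic_forms_ge2 : set (seq V -> K^o) :=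
  [set O | cyclic_forms O /\ forall s, (size s < 2)%N -> O s = 0].

(* Scalars have degree 0, so a form of degree [p] vanishes on homogeneous
   letters whose degrees do not add up to [- p]. *)
Definition form_degree (p : int) : set (seq V -> K^o) :=
  [set O | forall ds s, sgrs ds s -> p + \sum_(e <- ds) e != 0 -> O s = 0].

(* B has degree 2, hence so has Q |-> Omega_Q, and the Pinczon bracket has
   degree -2: the graded Lie algebra of cyclic forms is C(V)[2]. *)
Definition form_shifted_degree (d : int) : set (seq V -> K^o) :=
  form_degree (d + 2).

Definition fpart (q : bool) O : seq V -> K^o := fun s =>
  \sum_(p : (size s).-tuple bool | psum p == q) O (pars p s).

Variable b : {biscalar V}.

Definition form_of_degree0 : Prop := forall d e x y,
  x \in gr G d -> y \in gr G e -> d + e != 0 -> b x y = 0.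

(* Symmetry on V, hence with the sign given by the degrees |x| and |y|; this
   is what makes [symplectic_form] graded antisymmetric on V[1]. *)
Definition graded_symmetric : Prop := forall d e x y,
  x \in gr G d -> y \in gr G e -> b x y = (-1) ^ (d * e) * b y x.

Definition nondegenerate_form : Prop := forall x, (forall y, b x y = 0) -> x = 0.

(* B(x, y) = (-1)^deg(x) b(x, y) *)
Definition symplectic_form (x y : V) : K := b (pass true x) y.

(* Omega_Q (x_1, ..., x_(k+1)) = B(Q(x_1, ..., x_k), x_(k+1)) *)
Definition Omega Q : seq V -> K^o := fun s =>
  if s is x :: t then symplectic_form (Q (belast x t)) (last x t) else 0.

Definition quadratic_maps : set (seq V -> V) :=
  [set Q | multimaps Q /\ rotate (Omega Q) = Omega Q].

Definition dual_bases (n : nat) (e e' : n.-tuple V) : Prop :=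
  [/\ basis_of fullv e, basis_of fullv e'
    & forall i j, b (tnth e i) (tnth e' j) = (i == j)%:R].

Definition insert (x : V) O : seq V -> K^o := fun s => O (rcons s x).

(* sum_i (iota_(e_i) O) (x) (iota_(e'_i) O') with its Koszul signs.  There are
   two of them.  The letters x_1, ..., x_j are jumped over by O', which has the
   parity of Q' when O' = Omega_Q'.  Moreover
     B(u, v) = sum_i B(u, e_i) b(v, e'_i)
             = sum_i B(u, e_i) B(v, (-1)^deg(e'_i) e'_i),
   so that inserting [pass true e'_i] is what makes this form equal to
   B(Q(x_1, ..., x_k), Q'(x_(k+1), ..., x_(k+k'))) when O = Omega_Q and
   O' = Omega_Q'.  No homogeneity of the basis is needed. *)
Definition dual_tensor (n : nat) (e e' : n.-tuple V) O O' : seq V -> K^o :=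
  fun s => \sum_(i < n) \sum_(q : bool) \sum_(j < (size s).+1)
    insert (tnth e i) O (map (pass q) (take j s))
    * insert (pass true (tnth e' i)) (fpart q O') (drop j s).

Definition pinczon_bracket (n : nat) (e e' : n.-tuple V) O O' : seq V -> K^o :=
  Cycl (dual_tensor e e' O O').

End Forms.

(* Main.v *)
(** Split maps and forms into their even and odd parts.  A form [O] of parity [p]
    is cyclic exactly when moving its last letter [y] to the front multiplies its
    value by [(-1)^((p+1) deg y)], so every Koszul sign is a power of the parity
    involution [x |-> (-1)^(deg x) x] applied to a block of consecutive letters.

    The composition of multilinear maps is a graded pre-Lie product, because only
    the terms where the two inserted maps occupy disjoint blocks survive in the
    associator, and these are exchanged up to sign; hence the Lie bracket on [D].
    In the cyclic sum defining the Pinczon bracket of [Omega_Q] and [Omega_Q'],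
    the rotations whose last letter is an argument of [Q] add up to
    [Omega_(Q o Q')] by cyclicity of [Omega_Q], and the others to
    [- (-1)^(deg Q deg Q') Omega_(Q' o Q)] by antisymmetry of [B].

    A general cyclic form is a constant plus [Omega_Q] for a unique [Q] that may
    have a component of arity 0, so the Lie identities for forms follow from those
    for maps, apart from their constant terms, which are checked directly. *)
Require Import Defs.
From HB Require Import structures.
From mathcomp Require Import all_boot all_order all_algebra.
From mathcomp Require Import boolp classical_sets functions.
From mathcomp Require Import ring zify.

Set Implicit Arguments.
Unset Strict Implicit.
Unset Printing Implicit Defensive.
Import GRing.Theory.
Local Open Scope ring_scope.

(** * Multilinear functions on words *)

(** Koszul signs depend on parities, whereas the gradings ask for integer degrees. Signs are
    therefore carried by [has_parity], a commutation rule with the parity involution that holds on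
    arbitrary letters, and [homog_parity] passes from degree to parity. Taking a part is the
    projection $(1 \pm \text{conjugation})/2$; characteristic 0 enters here, as $2 \ne 0$.

    Sums over positions are written as sums over cuts of a word, so that reindexing nested
    compositions becomes coassociativity of deconcatenation instead of arithmetic on indices.

    Each subspace is shown to be graded by writing it as the kernel of a linear map that shifts
    degrees: the defect of cyclicity, or the truncation to short words.

    The obstacle for the whole of $\mathcal C(V)$ is low arity. A component in $\mathcal C^1$
    corresponds to a constant map, and two of these have a scalar bracket $B(Q(),Q'())$ that no map
    records. The Jacobi identity thus has a constant term of its own, which involves the components
    of arity 0 and 1 of the maps and needs the cyclicity of the latter. *)

Section Splits.
Variables (T : Type) (W : nmodType).
Implicit Types (F : seq T -> seq T -> W) (s t : seq T).

(** Summation over the deconcatenation coproduct of the word [s]; empty pieces are allowed, so maps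
    of arity 0 are covered. *)
Definition splits F s : W :=
  \sum_(i < (size s).+1) F (take i s) (drop i s).

Lemma splits_nil F : splits F [::] = F [::] [::].
Proof. by rewrite /splits big_ord1. Qed.

Lemma splits_cons F x s :
  splits F (x :: s) = F [::] (x :: s) + splits (fun a b => F (x :: a) b) s.
Proof. by rewrite /splits big_ord_recl. Qed.

Lemma eq_splits F F' s :
  (forall a b, s = a ++ b -> F a b = F' a b) -> splits F s = splits F' s.
Proof. by move=> eqF; apply: eq_bigr => i _; apply: eqF; rewrite cat_take_drop. Qed.

Lemma splits_ind (P : W -> Prop) F s :
  P 0 -> (forall x y, P x -> P y -> P (x + y)) ->
  (forall a b, s = a ++ b -> P (F a b)) -> P (splits F s).
Proof.
move=> P0 PD PF; apply: (big_ind P) => // i _.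
by apply: PF; rewrite cat_take_drop.
Qed.

(** The marked letter [x] falls into the right piece or into the left one. Applied to a letter that
    is itself the value of an inserted map, this separates nested from disjoint insertions. *)
Lemma splits_cat_cons F s x t :
  splits F (s ++ x :: t) = splits (fun a b => F a (b ++ x :: t)) s
                         + splits (fun a b => F (s ++ x :: a) b) t.
Proof.
elim: s F => [|y s IHs] F /=; first by rewrite splits_cons splits_nil.
by rewrite !splits_cons IHs addrA.
Qed.

Lemma splitsD F F' s :
  splits (fun a b => F a b + F' a b) s = splits F s + splits F' s.
Proof. exact: big_split. Qed.

Lemma splits_sum (I : Type) (r : seq I) (P : pred I)
    (F : I -> seq T -> seq T -> W) s :
  splits (fun a b => \sum_(i <- r | P i) F i a b) s
  = \sum_(i <- r | P i) splits (F i) s.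
Proof. by rewrite /splits exchange_big. Qed.

(** Coassociativity of deconcatenation. *)
Lemma splits_assoc (F : seq T -> seq T -> seq T -> W) s :
  splits (fun u c => splits (fun a b => F a b c) u) s
  = splits (fun a v => splits (fun b c => F a b c) v) s.
Proof.
elim: s F => [|x s IHs] F; first by rewrite !splits_nil.
rewrite !splits_cons splits_nil /=.
under [in LHS]eq_splits do rewrite splits_cons.
by rewrite splitsD IHs addrA.
Qed.

Lemma splits_map (f : T -> T) F s :
  splits F (map f s) = splits (fun a b => F (map f a) (map f b)) s.
Proof.
by rewrite /splits size_map; apply: eq_bigr => i _; rewrite map_take map_drop.
Qed.

End Splits.

Lemma raddf_splits (T : Type) (W W' : nmodType) (f : W -> W') F (s : seq T) :
  f 0 = 0 -> {morph f : x y / x + y} ->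
  f (splits F s) = splits (fun a b => f (F a b)) s.
Proof. by move=> f0 fD; apply: (big_morph f fD f0). Qed.

Section Multilinear.
Variables (K : fieldType) (V W : lmodType K).
Implicit Types F : seq V -> W.

Definition multilinear F := forall s t (a : K) x y,
  F (s ++ (a *: x + y) :: t) = a *: F (s ++ x :: t) + F (s ++ y :: t).

Lemma multilinear0 F s t : multilinear F -> F (s ++ 0 :: t) = 0.
Proof.
by move=> Fl; have := Fl s t (-1) 0 0; rewrite scaler0 addr0 scaleN1r addNr.
Qed.

Lemma multilinearD F s t x y : multilinear F ->
  F (s ++ (x + y) :: t) = F (s ++ x :: t) + F (s ++ y :: t).
Proof. by move=> Fl; have := Fl s t 1 x y; rewrite !scale1r. Qed.

Lemma multilinearZ F s t a x : multilinear F ->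
  F (s ++ (a *: x) :: t) = a *: F (s ++ x :: t).
Proof.
by move=> Fl; have := Fl s t a x 0; rewrite !addr0 (multilinear0 _ _ Fl) addr0.
Qed.

Lemma multilinear_sum (I : Type) (r : seq I) (P : pred I) (f : I -> V) F s t :
  multilinear F ->
  F (s ++ (\sum_(i <- r | P i) f i) :: t)
  = \sum_(i <- r | P i) F (s ++ f i :: t).
Proof.
move=> Fl; elim: r => [|i r IHr]; first by rewrite !big_nil multilinear0.
by rewrite !big_cons; case: (P i); rewrite // multilinearD // IHr.
Qed.

Lemma multilinear_comb F F' (a : K) : multilinear F -> multilinear F' ->
  multilinear (a *: F + F').
Proof.
move=> Fl F'l s t c x y; rewrite !fctE Fl F'l !scalerDr !scalerA mulrC.
by rewrite addrACA.
Qed.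

Lemma multilinear_zero : multilinear (0 : seq V -> W).
Proof. by move=> s t a x y; rewrite [RHS](_ : _ = a *: 0 + 0) // scaler0 addr0. Qed.

Lemma multilinear_map (f : {linear V -> V}) F :
  multilinear F -> multilinear (fun s => F (map f s)).
Proof. by move=> Fl s t a x y; rewrite !map_cat /= linearP Fl. Qed.

Lemma multilinear_splits (F : seq V -> seq V -> W) :
  (forall b, multilinear (F^~ b)) -> (forall a, multilinear (F a)) ->
  multilinear (splits F).
Proof.
move=> Fl Fr s t c x y; rewrite !splits_cat_cons scalerDr addrACA.
congr (_ + _).
  rewrite /splits scaler_sumr -big_split.
  by apply: eq_bigr => i _; rewrite Fr.
rewrite /splits scaler_sumr -big_split.
by apply: eq_bigr => i _; rewrite (Fl _ s).
Qed.

Lemma multilinear_splits_param (G : seq V -> seq V -> seq V -> W) s :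
  (forall a b, multilinear (fun u => G u a b)) ->
  multilinear (fun u => splits (G u) s).
Proof.
move=> Gl u v c x y; rewrite /splits scaler_sumr -big_split.
by apply: eq_bigr => i _; rewrite Gl.
Qed.

(** Instances are [pars], with the two parity projections, and the projection of each letter onto a
    prescribed degree used in [component]. *)
Definition mapzip (I : Type) (pr : I -> V -> V) (p : seq I) (s : seq V) :=
  [seq pr ix.1 ix.2 | ix <- zip p s].

Lemma big_tuple_cons (I : finType) n (M : nmodType) (f : n.+1.-tuple I -> M) :
  \sum_p f p = \sum_i \sum_(p : n.-tuple I) f [tuple of i :: p].
Proof.
rewrite pair_big /=.
rewrite (reindex (fun ip : I * n.-tuple I => [tuple of ip.1 :: ip.2])) //=.
exists (fun p : n.+1.-tuple I => (thead p, [tuple of behead p])).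
  by case=> i p _; congr (_, _); apply: val_inj.
by move=> p _; rewrite [RHS]tuple_eta.
Qed.

Lemma multilinear_expand (I : finType) (pr : I -> V -> V) F s :
  (forall x, \sum_i pr i x = x) -> multilinear F ->
  \sum_(p : (size s).-tuple I) F (mapzip pr p s) = F s.
Proof.
move=> prE Fl; suff main u : \sum_(p : (size s).-tuple I) F (u ++ mapzip pr p s)
  = F (u ++ s) by exact: (main [::]).
elim: s u => [|x s IHs] u /=.
  rewrite (eq_bigr (fun _ => F (u ++ [::]))) => [|p _]; last by rewrite tuple0.
  by rewrite sumr_const card_tuple expn0.
rewrite big_tuple_cons /mapzip /=.
under eq_bigr => i _.
  under eq_bigr => p _ do rewrite -cat_rcons.
  rewrite IHs cat_rcons; over.
by rewrite -multilinear_sum // prE.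
Qed.

End Multilinear.

(** * Degree and parity *)

Section GradedSubspaces.
Variable K : fieldType.

Lemma subspace0 (L : lmodType K) (A : set L) : subspace A -> A 0.
Proof. by case. Qed.

Lemma subspaceD (L : lmodType K) (A : set L) x y :
  subspace A -> A x -> A y -> A (x + y).
Proof. by case=> _ AP /(AP 1)/[apply]; rewrite scale1r. Qed.

Lemma subspaceZ (L : lmodType K) (A : set L) a x :
  subspace A -> A x -> A (a *: x).
Proof. by case=> A0 AP Ax; have := AP a x 0 Ax A0; rewrite addr0. Qed.

Lemma subspace_sum (L : lmodType K) (A : set L) (I : Type) (r : seq I) f :
  subspace A -> (forall i, A (f i)) -> A (\sum_(i <- r) f i).
Proof.
move=> sA Af; elim/big_rec: _ => [|i x _ Ax]; first exact: subspace0.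
exact: subspaceD.
Qed.

Lemma subspace_setI (L : lmodType K) (A B : set L) :
  subspace A -> subspace B -> subspace (A `&` B)%classic.
Proof.
move=> [A0 AP] [B0 BP]; split=> // a x y [Ax Bx] [Ay By].
by split; [apply: AP | apply: BP].
Qed.

(* A linear map that shifts degrees kills each component of an element of its
   kernel, because the images of the components lie in different degrees. *)
Lemma graded_subspace_ker (L L' : lmodType K) (A : set L) (deg : int -> set L)
    (A' : set L') (deg' : int -> set L') (phi : L -> L') (k : int) :
  graded_subspace A deg -> graded_subspace A' deg' ->
  (forall a x y, A x -> A y -> phi (a *: x + y) = a *: phi x + phi y) ->
  (forall d x, A x -> deg d x -> (A' `&` deg' (d + k))%classic (phi x)) ->
  graded_subspace (fun x => A x /\ phi x = 0) deg.
Proof.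
move=> [sA sAd Aspan Adir] [sA' sA'd _ A'dir] phiP phi_deg.
have phi0 : phi 0 = 0.
  have /(_ (subspace0 sA) (subspace0 sA)) := phiP (-1) 0 0.
  by rewrite scaler0 addr0 scaleN1r addNr.
have sker : subspace (fun x => A x /\ phi x = 0).
  split=> [|a x y [Ax x0] [Ay y0]]; first by split=> //; case: sA.
  split; first by case: sA => _; apply.
  by rewrite phiP // x0 y0 scaler0 addr0.
split=> // [d|x [Ax phix0]|ds c Uds cP].
- have [Ad0 AdP] := sAd d; have [A0 AP] := sker.
  split=> [|a x y [Ax xd] [Ay yd]]; first by split=> //; case: Ad0.
  split; first exact: AP.
  by have [] := AdP a x y (conj Ax.1 xd) (conj Ay.1 yd).
- have [ds [c [cP xE]]] := Aspan x Ax.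
  (* The spanning property allows repeated degrees in [ds]; the multiplicities are absorbed into
     [c'], since directness requires distinct degrees. *)
  pose c' d := (count_mem d ds)%:R *: c d.
  have c'P d : (A `&` deg d)%classic (c' d) by apply: subspaceZ.
  have {}xE : x = \sum_(d <- undup ds) c' d.
    rewrite xE -[LHS]big_undup_iterop_count; apply: eq_bigr => d _.
    rewrite /c' scaler_nat.
    by elim: (count_mem d ds) => // n IHn; rewrite iteropS /= mulrS -iteropE.
  have phic' d : phi (c' d) = 0.
    have [ds_d|/count_memPn ds'd] := boolP (d \in ds); last first.
      by rewrite /c' ds'd scale0r.
    (* Directness in [A'] is applied to the images, reindexed by the target degree [e = d + k]. *)
    have := A'dir [seq e + k | e <- undup ds] (fun e => phi (c' (e - k))).
    move=> /(_ _ _ _ (d + k)); rewrite addrK; apply.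
    + by rewrite map_inj_uniq ?undup_uniq //; apply: addIr.
    + by move=> e; have := phi_deg _ _ (c'P (e - k)).1 (c'P _).2; rewrite subrK.
    + rewrite big_map; under eq_bigr do rewrite addrK.
      rewrite -[RHS]phix0 xE; elim: (undup ds) => [|e r IHr].
        by rewrite !big_nil phi0.
      rewrite !big_cons IHr; have := phiP 1 (c' e) (\sum_(j <- r) c' j).
      rewrite !scale1r => ->//; first by case: (c'P e).
      by apply: subspace_sum => // j; case: (c'P j).
    + by apply/mapP; exists d; rewrite ?mem_undup.
  by exists (undup ds), c'; split=> // d; have [] := c'P d.
- by apply: Adir => // d; have [[]] := cP d.
Qed.

Lemma graded_Lie_subalgebra_algebra (L : lmodType K) (A : set L)
    (deg : int -> set L) (br : L -> L -> L) (S : set L) :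
  graded_Lie_subalgebra A deg br S -> graded_Lie_algebra S deg br.
Proof.
case=> -[_ _ linl linr brdeg skew jac] SA Sgr Scl.
split=> //.
- by move=> a x y z /SA + /SA + /SA; apply: linl.
- by move=> a x y z /SA + /SA + /SA; apply: linr.
- by move=> d e x y /SA + /SA; apply: brdeg.
- by move=> d e x y /SA + /SA; apply: skew.
- by move=> d e x y z /SA + /SA + /SA; apply: jac.
Qed.

End GradedSubspaces.

(* [gpar], [gsgn], [gpart] and [homog] below are [par], [pass], [mpart] or [fpart],
   and [multimap_degree] or [form_degree] for an arbitrary graded codomain [W], so
   that maps and forms are handled at once. *)
Record decomposition (K : fieldType) (W : lmodType K) := Decomposition {
  proj : int -> W -> W;
  degs : seq int;
  degs_uniq : uniq degs;
  proj_linear : forall d (a : K) x y,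
    proj d (a *: x + y) = a *: proj d x + proj d y;
  proj_out : forall d x, d \notin degs -> proj d x = 0;
  projK : forall d e x, proj d (proj e x) = if d == e then proj e x else 0;
  sum_proj : forall x, \sum_(d <- degs) proj d x = x
}.

Section Parity.
Variables (K : fieldType) (W : lmodType K) (D : decomposition W).
Implicit Types x y : W.

HB.instance Definition _ d :=
  GRing.isLinear.Build K W W *:%R (proj D d) (fun a x y => proj_linear D d a x y).

Definition parity (d : int) : bool := odd `|d|%N.

Lemma parityD d e : parity (d + e) = parity d (+) parity e.
Proof.
rewrite /parity; apply/idP/idP; lia.
Qed.

Definition gpar (q : bool) x := \sum_(d <- degs D | parity d == q) proj D d x.

Definition gsgn (q : bool) x := gpar false x + (-1) ^+ q *: gpar true x.

Lemma gpar_is_linear q : linear (gpar q).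
Proof.
move=> a x y; rewrite /gpar scaler_sumr -big_split.
by apply: eq_bigr => d _; rewrite linearP.
Qed.
HB.instance Definition _ q :=
  GRing.isLinear.Build K W W *:%R (gpar q) (gpar_is_linear q).

Lemma gsgn_is_linear q : linear (gsgn q).
Proof.
by move=> a x y; rewrite /gsgn !linearP scalerDr addrACA !scalerA mulrC.
Qed.
HB.instance Definition _ q :=
  GRing.isLinear.Build K W W *:%R (gsgn q) (gsgn_is_linear q).

Lemma sum_gpar x : \sum_q gpar q x = x.
Proof.
rewrite -[RHS](sum_proj D) big_bool /= /gpar.
rewrite addrC.
rewrite [RHS](bigID (fun d => parity d == false)) /=; congr (_ + _).
by apply: eq_bigl => d; case: (parity d).
Qed.

Lemma gpar_proj q d x :
  gpar q (proj D d x) = if parity d == q then proj D d x else 0.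
Proof.
rewrite /gpar; under eq_bigr do rewrite projK.
have [Dd|D'd] := boolP (d \in degs D); last first.
  by rewrite big1 => [|e _]; rewrite (proj_out _ D'd) if_same.
rewrite big_mkcond (bigD1_seq d) ?degs_uniq //= eqxx big1 ?addr0 // => e.
by move=> /negPf->; rewrite if_same.
Qed.

Lemma gparK p q x : gpar p (gpar q x) = if p == q then gpar q x else 0.
Proof.
rewrite {2}/gpar linear_sum /=.
under eq_bigr => d /eqP qd do rewrite gpar_proj qd eq_sym.
by case: (p == q) => //; rewrite big1.
Qed.

Lemma gsgn_gpar q p x : gsgn q (gpar p x) = (-1) ^+ (p && q) *: gpar p x.
Proof.
rewrite /gsgn !gparK; case: p => /=; last by rewrite scaler0 addr0 scale1r.
by rewrite add0r.
Qed.

Lemma gsgn_false x : gsgn false x = x.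
Proof. by rewrite /gsgn scale1r -[RHS]sum_gpar big_bool addrC. Qed.

Lemma gpar_gsgn p q x : gpar p (gsgn q x) = (-1) ^+ (p && q) *: gpar p x.
Proof.
rewrite /gsgn linearD linearZ /= !gparK.
by case: p; rewrite /= ?scaler0 ?addr0 ?add0r ?scale1r.
Qed.

(** The maps [gsgn q] form an action of $\mathbb Z/2$: successive jumps over a letter accumulate by
    exclusive or, which reduces sign bookkeeping to Boolean identities. *)
Lemma gsgn_addb p q x : gsgn p (gsgn q x) = gsgn (p (+) q) x.
Proof.
rewrite [LHS]/gsgn !gpar_gsgn /= scale1r scalerA.
by rewrite [in RHS]/gsgn signr_addb.
Qed.

Lemma gsgnK q : involutive (gsgn q).
Proof. by move=> x; rewrite gsgn_addb addbb gsgn_false. Qed.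

Lemma gsgn_hom d q x :
  proj D d x = x -> gsgn q x = (-1) ^+ (parity d && q) *: x.
Proof.
move=> <-; rewrite /gsgn !gpar_proj.
by case: (parity d); rewrite /= ?scaler0 ?addr0 ?add0r ?scale1r.
Qed.

End Parity.

Section Parts.
Variables (K : fieldType) (nz2 : (2%:R : K) != 0).
Variables (V W : lmodType K) (D : decomposition V) (DW : decomposition W).
Implicit Types (F : seq V -> W) (s : seq V).

(** Parity as an eigenvalue condition for conjugation by the involution. It can be used as a
    rewriting rule without decomposing the letters. *)
Definition has_parity (q : bool) F := forall r s,
  F (map (gsgn D r) s) = (-1) ^+ (q && r) *: gsgn DW r (F s).

Definition gpart (q : bool) F : seq V -> W := fun s =>
  \sum_(p : (size s).-tuple bool)
    gpar DW (q (+) odd (count id p)) (F (mapzip (gpar D) p s)).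

Lemma multilinear_gsgn F r :
  multilinear F -> multilinear (fun s => gsgn DW r (F (map (gsgn D r) s))).
Proof. by move=> Fl s t a x y; rewrite (multilinear_map _ Fl) linearP. Qed.

Lemma mapzip_gsgn r (p : seq bool) s :
  mapzip (gpar D) p (map (gsgn D r) s) = map (gsgn D r) (mapzip (gpar D) p s).
Proof.
elim: p s => [|c p IHp] [|x s] //=; rewrite /mapzip /= gpar_gsgn gsgn_gpar.
by congr (_ :: _); apply: IHp.
Qed.

Lemma gsgn_mapzip r (F : seq V -> W) (p : seq bool) s : multilinear F ->
  size p = size s -> F (map (gsgn D r) (mapzip (gpar D) p s))
  = (-1) ^+ (odd (count id p) && r) *: F (mapzip (gpar D) p s).
Proof.
move=> Fl; suff main u : size p = size s ->
    F (u ++ map (gsgn D r) (mapzip (gpar D) p s))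
    = (-1) ^+ (odd (count id p) && r) *: F (u ++ mapzip (gpar D) p s).
  exact: (main [::]).
elim: p s u => [|c p IHp] [|x s] u //=; first by rewrite scale1r.
case=> /IHp {}IHp; rewrite gsgn_gpar multilinearZ // -cat_rcons IHp cat_rcons.
by rewrite scalerA oddD oddb andb_addl signr_addb.
Qed.

Lemma gpart_parity q F : multilinear F -> has_parity q (gpart q F).
Proof.
move=> Fl r s; rewrite /gpart.
(* The index type of the sum depends on [size s], so replacing [s] by its image under [map] needs
   this transport. *)
have E n (sn : size s = n) : \sum_(p : (size s).-tuple bool)
    gpar DW (q (+) odd (count id p)) (F (mapzip (gpar D) p s))
  = \sum_(p : n.-tuple bool)
    gpar DW (q (+) odd (count id p)) (F (mapzip (gpar D) p s)).
  by rewrite -sn.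
rewrite (E _ (esym (size_map (gsgn D r) s))).
rewrite linear_sum scaler_sumr; apply: eq_bigr => p _ /=.
rewrite mapzip_gsgn gsgn_mapzip ?size_tuple ?size_map // linearZ gsgn_gpar scalerA /=.
by rewrite -signr_addb -andb_addl addKb.
Qed.

Lemma sum_gpart F : multilinear F -> F = \sum_q gpart q F.
Proof.
move=> Fl; apply/funext => s; rewrite -[LHS](multilinear_expand s (sum_gpar D) Fl).
rewrite fct_sumE exchange_big; apply: eq_bigr => p _ /=.
rewrite -[LHS](sum_gpar DW) !big_bool /=; case: (odd _) => //=.
by rewrite addrC.
Qed.

(** The parts are the two eigenprojections of conjugation by the parity involution, which squares to
    the identity. This form, free of tuples, yields multilinearity of the parts and linearity in
    [F]. *)
Lemma gpartE q F : multilinear F -> gpart q F =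
  2%:R^-1 *: (F + (-1) ^+ q *: (fun s => gsgn DW true (F (map (gsgn D true) s)))).
Proof.
move=> Fl; apply/funext => s; rewrite !fctE [in RHS](sum_gpart Fl).
rewrite !fct_sumE !big_bool /= !(gpart_parity _ Fl) /= expr1 expr0.
rewrite scaleN1r scale1r [gsgn DW true (_ + _)]linearD linearN /=.
rewrite !gsgn_addb /= !gsgn_false.
have E (w : W) : w = 2%:R^-1 *: (w + w).
  by rewrite -mulr2n -scaler_nat scalerA mulVf ?scale1r.
case: q; first by rewrite scaleN1r opprD opprK addrACA subrr addr0 -E.
by rewrite scale1r addrACA subrr add0r -E.
Qed.

Lemma gpart_multilinear q F : multilinear F -> multilinear (gpart q F).
Proof.
move=> Fl; rewrite gpartE // -[X in multilinear X]addr0.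
apply: multilinear_comb; last exact: multilinear_zero.
by rewrite addrC; apply: multilinear_comb => //; apply: multilinear_gsgn.
Qed.

Lemma gpart_id p q F : multilinear F -> has_parity p F ->
  gpart q F = if p == q then F else 0.
Proof.
move=> Fl Fp; rewrite gpartE //; apply/funext => s; rewrite !fctE Fp andbT.
rewrite linearZ /= gsgn_addb gsgn_false scalerA -signr_addb eq_sym.
have E (w : W) : 2%:R^-1 *: (w + w) = w.
  by rewrite -mulr2n -scaler_nat scalerA mulVf ?scale1r.
case: eqP => [->|/eqP]; first by rewrite addbb scale1r E.
by rewrite -negb_add negbK => ->; rewrite scaleN1r subrr scaler0.
Qed.

Lemma gpart_comb q a F F' : multilinear F -> multilinear F' ->
  gpart q (a *: F + F') = a *: gpart q F + gpart q F'.
Proof.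
move=> Fl F'l; rewrite !gpartE //; last exact: multilinear_comb.
apply/funext => s; rewrite !fctE.
rewrite [a *: (2%:R^-1 *: _)]scalerA mulrC -scalerA -scalerDr.
congr (_ *: _); rewrite [gsgn DW true (_ + _)]linearP /=.
move: (gsgn _ _ _) (gsgn _ _ _) => x x'.
by rewrite !scalerDr addrACA !scalerA mulrC.
Qed.

Lemma has_parity_comb p a F F' :
  has_parity p F -> has_parity p F' -> has_parity p (a *: F + F').
Proof.
move=> Fp F'p r s; rewrite !fctE Fp F'p [gsgn DW r (_ + _)]linearP /=.
move: (gsgn _ _ _) (gsgn _ _ _) => x x'.
by rewrite scalerDr !scalerA mulrC.
Qed.

Definition homlist (ds : seq int) s := all2 (fun d x => proj D d x == x) ds s.

Definition homog (d : int) F := forall ds s, homlist ds s ->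
  proj DW (d + \sum_(e <- ds) e) (F s) = F s.

Lemma homlist_cat ds s t : homlist ds (s ++ t) ->
  exists ds1 ds2, [/\ ds = ds1 ++ ds2, homlist ds1 s & homlist ds2 t].
Proof.
elim: s ds => [|x s IHs] ds; first by exists [::], ds.
case: ds => //= d ds /andP[dx /IHs[ds1 [ds2 [-> h1 h2]]]].
by exists (d :: ds1), ds2; rewrite /= dx.
Qed.

Lemma cat_homlist ds1 ds2 s t :
  homlist ds1 s -> homlist ds2 t -> homlist (ds1 ++ ds2) (s ++ t).
Proof.
elim: s ds1 => [|x s IHs] [|d ds1] //= /andP[-> /IHs h] /h.
by rewrite /homlist /=.
Qed.

Lemma gsgn_homlist ds s r : homlist ds s -> homlist ds (map (gsgn D r) s).
Proof.
elim: s ds => [|x s IHs] [|d ds] //= /andP[/eqP dx /IHs h].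
by rewrite /homlist /= -/(homlist _ _) h andbT (gsgn_hom _ dx) linearZ /= dx.
Qed.

Lemma homlist_ext F F' : multilinear F -> multilinear F' ->
  (forall ds s, homlist ds s -> F s = F' s) -> F = F'.
Proof.
move=> Fl F'l eqF; apply/funext => s.
suff main ds u : homlist ds u -> F (u ++ s) = F' (u ++ s) by apply: (main [::] [::]).
elim: s ds u => [|x s IHs] ds u du; first by rewrite cats0 (eqF ds).
rewrite -[x](sum_proj D) !multilinear_sum //; apply: eq_bigr => d _.
rewrite -!cat_rcons (IHs (rcons ds d)) // -!cats1.
by apply: cat_homlist; rewrite //= /homlist /= projK !eqxx.
Qed.

(** Both sides are multilinear, so homogeneous letters suffice. There the letters contribute the
    parity of their total degree and the value that of [d] plus this total; the difference is the
    parity of [d]. *)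
Lemma homog_parity d F : multilinear F -> homog d F -> has_parity (parity d) F.
Proof.
move=> Fl Fd r s.
have Gl : multilinear (fun s => (-1) ^+ (parity d && r) *: gsgn DW r (F s)).
  move=> u v a x y; rewrite Fl [gsgn DW r (_ + _)]linearP /=.
  move: (gsgn _ _ _) (gsgn _ _ _) => z z'.
  by rewrite scalerDr !scalerA mulrC.
have Fl' := multilinear_map (gsgn D r) Fl.
suff /(congr1 (@^~ s)) : (fun s => F (map (gsgn D r) s))
  = (fun s => (-1) ^+ (parity d && r) *: gsgn DW r (F s)) by [].
apply: homlist_ext Fl' Gl _ => ds {}s hs /=.
rewrite (gsgn_hom _ (Fd _ _ hs)) scalerA.
rewrite -signr_addb parityD andb_addl addKb.
suff main u : F (u ++ map (gsgn D r) s)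
    = (-1) ^+ (parity (\sum_(e <- ds) e) && r) *: F (u ++ s).
  exact: (main [::]).
elim: s ds u {Fd} hs => [|x s IHs] [|e ds] u //=.
  by rewrite big_nil scale1r.
move=> /andP[/eqP ex /IHs{}IHs]; rewrite (gsgn_hom _ ex) multilinearZ //.
rewrite -cat_rcons IHs cat_rcons scalerA -signr_addb.
by rewrite big_cons parityD andb_addl.
Qed.

End Parts.

(** * Homogeneous components of multilinear functions *)

Section Components.
Variables (K : fieldType) (V : vectType K) (W : lmodType K).
Variables (D : decomposition V) (DW : decomposition W).
Implicit Types (F : seq V -> W) (s : seq V).

Lemma sum_proj_sup r x : uniq r -> {subset degs DW <= r} ->
  \sum_(d <- r) proj DW d x = x.
Proof.
move=> Ur sDr; rewrite (bigID (mem (degs DW))) /= [X in _ + X]big1 ?addr0.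
  rewrite -big_filter -[RHS](sum_proj DW); apply: perm_big.
  apply: uniq_perm; rewrite ?filter_uniq ?degs_uniq // => d.
  by rewrite mem_filter /= andb_idr // => /sDr.
by move=> d; apply: proj_out.
Qed.

(** [multilinear_expand] sums over a finite type, so degrees are replaced by their positions in
    [degs D]. *)
Let I := 'I_(size (degs D)).
Let dg (i : I) : int := (degs D)`_i.
Let pr (i : I) : V -> V := proj D (dg i).

Lemma sum_pr x : \sum_i pr i x = x.
Proof. by rewrite -[RHS](sum_proj D) (big_nth 0) big_mkord. Qed.

Definition component d F : seq V -> W := fun s =>
  \sum_(p : (size s).-tuple I)
    proj DW (d + \sum_(i <- p) dg i) (F (mapzip pr p s)).

Lemma componentE n d F s : size s = n -> component d F s =
  \sum_(p : n.-tuple I) proj DW (d + \sum_(i <- p) dg i) (F (mapzip pr p s)).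
Proof. by move<-. Qed.

Lemma component_multilinear d F : multilinear F -> multilinear (component d F).
Proof.
move=> Fl s t a x y; have szE z : size (s ++ z :: t) = (size s + (size t).+1)%N.
  by rewrite size_cat.
rewrite !(componentE _ _ (szE _)) scaler_sumr -big_split; apply: eq_bigr => p _ /=.
rewrite -linearP /=; congr (proj _ _ _).
have szp1 : size (take (size s) p) = size s.
  by rewrite size_takel // size_tuple leq_addr.
have [i [p2 pE]] : exists i p2, drop (size s) p = i :: p2.
  case: (drop (size s) p) (size_drop (size s) p) => [|i p2]; last by exists i, p2.
  by rewrite size_tuple addKn.
have E z : mapzip pr p (s ++ z :: t)
         = mapzip pr (take (size s) p) s ++ pr i z :: mapzip pr p2 t.
  by rewrite /mapzip -{1}(cat_take_drop (size s) p) pE zip_cat // map_cat.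
by rewrite !E /pr linearP Fl.
Qed.

Lemma component_polylinear d F : polylinear F -> polylinear (component d F).
Proof.
case=> Fl [N FN]; split; first exact: component_multilinear.
exists N => s sN; rewrite /component big1 // => p _.
by rewrite FN ?linear0 // size_map size_zip size_tuple minnn.
Qed.

(** Projecting a homogeneous letter onto a wrong degree gives 0. Hence, on a homogeneous word, the
    tuples that contribute to [component] have the total degree of the word. *)
Lemma mapzip_homlist ds s (p : seq I) : homlist D ds s -> size p = size s ->
  0 \in mapzip pr p s \/ \sum_(i <- p) dg i = \sum_(e <- ds) e.
Proof.
elim: s ds p => [|x s IHs] [|e ds] [|i p] //=; first by right; rewrite !big_nil.
move=> /andP[/eqP ex /IHs{}IHs] [/IHs[h|h]].
  by left; rewrite in_cons [X in _ || X]h orbT.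
have [ie|/eqP ie] := eqVneq (dg i) e; first by right; rewrite !big_cons h ie.
left; rewrite in_cons /= /pr -ex projK.
by rewrite (introF eqP ie) eqxx.
Qed.

Lemma component_homog d F : multilinear F -> homog D DW d (component d F).
Proof.
move=> Fl ds s hs; rewrite /component linear_sum; apply: eq_bigr => p _ /=.
have := mapzip_homlist hs (size_tuple p).
case=> [/splitPr[u v]|->]; first by rewrite multilinear0 // !linear0.
by rewrite projK eqxx.
Qed.

Lemma sum_component F : polylinear F -> exists ds,
  F = \sum_(d <- ds) component d F.
Proof.
case=> Fl [N FN].
(* The bound [N] on the arity leaves finitely many total degrees [c] of the letters; a value of
   degree [e] on them belongs to the component of degree [e - c]. *)
pose cs := flatten [seq [seq \sum_(i <- tval p) dg i | p : n.-tuple I]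
                   | n <- iota 0 N.+1].
exists (undup [seq e - c | e <- degs DW, c <- cs]); apply/funext => s.
rewrite fct_sumE /component exchange_big /=.
have [sN|Ns] := leqP (size s) N; last first.
  rewrite FN // big1 // => p _; rewrite big1 // => d _.
  by rewrite FN ?linear0 // size_map size_zip size_tuple minnn.
rewrite -[LHS](multilinear_expand s sum_pr Fl); apply: eq_bigr => p _.
set c := \sum_(i <- p) _.
rewrite -(big_map (fun d => d + c) xpredT (fun d => proj DW d (F (mapzip pr p s)))).
rewrite sum_proj_sup ?map_inj_uniq ?undup_uniq //; first exact: addIr.
move=> e De; apply/mapP; exists (e - c); rewrite ?subrK // mem_undup.
apply/allpairsP; exists (e, c); split=> //=.
apply/flatten_mapP; exists (size s); first by rewrite mem_iota add0n ltnS.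
by apply/mapP; exists p; rewrite // mem_enum.
Qed.

Lemma polylinear_subspace : subspace (@polylinear K V W).
Proof.
split=> [|a F F' [Fl [N FN]] [F'l [M FM]]].
  by split; [apply: multilinear_zero | exists 0%N].
split; first exact: multilinear_comb.
exists (maxn N M) => s; rewrite gtn_max => /andP[sN sM].
by rewrite !fctE FN // FM // scaler0 addr0.
Qed.

Lemma homog_subspace d : subspace (homog D DW d).
Proof.
split=> [ds s _|a F F' Fd F'd ds s hs]; first by rewrite linear0.
by rewrite !fctE linearP /= Fd // F'd.
Qed.

Lemma polylinear_graded : graded_subspace (@polylinear K V W) (homog D DW).
Proof.
split=> [|d|F Fp|ds c Uds cP c0 d ds_d].
- exact: polylinear_subspace.
- exact: subspace_setI polylinear_subspace (homog_subspace d).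
- have [ds ->] := sum_component Fp; exists ds, (component^~ F); split=> // d.
  by split; [apply: component_polylinear | case: Fp => /component_homog].
- have [[cl _] _] := cP d.
  apply: (homlist_ext (D := D) cl (@multilinear_zero K V W)) => es s hs.
  have /(congr1 (fun F => proj DW (d + \sum_(e <- es) e) (F s))) := c0.
  rewrite fct_sumE linear_sum linear0 (bigD1_seq d) //=.
  rewrite (cP d).2 // big1 ?addr0 // => e ed.
  rewrite -((cP e).2 es) // projK; case: eqP => // /addIr de.
  by rewrite de eqxx in ed.
Qed.

End Components.

(** * The shifted grading of [V] and the trivial grading of the scalars *)

Section GradingDecomposition.
Variables (K : fieldType) (V : vectType K) (G : grading V).

(** Indexed by deg rather than by $|x|$, whence the shift by 1. The guard makes the projection
    vanish outside the support by definition. *)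
Definition gproj (d : int) (x : V) : V :=
  if d + 1 \in gr_supp G then sumv_pi_for (gr_full G) (d + 1) x else 0.

Definition sdegs : seq int := [seq d - 1 | d <- gr_supp G].

Lemma mem_sdegs d : (d \in sdegs) = (d + 1 \in gr_supp G).
Proof.
apply/mapP/idP => [[e Ge ->]|Gd]; first by rewrite subrK.
by exists (d + 1); rewrite // addrK.
Qed.

Lemma gproj_linear d (a : K) x y : gproj d (a *: x + y) = a *: gproj d x + gproj d y.
Proof.
by rewrite /gproj; case: ifP; rewrite ?linearP // scaler0 addr0.
Qed.

Lemma gproj_out d x : d \notin sdegs -> gproj d x = 0.
Proof. by rewrite mem_sdegs /gproj => /negPf->. Qed.

Lemma gproj_sgr d x : gproj d x \in sgr G d.
Proof.
by rewrite /gproj; case: ifP => _; rewrite ?mem0v //; apply: memv_sum_pi.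
Qed.

Lemma sum_gproj x : \sum_(d <- sdegs) gproj d x = x.
Proof.
rewrite big_map -[RHS](sumv_pi_uniq_sum (gr_full G)) ?memvf ?filter_predT ?gr_uniq //.
by apply: eq_big_seq => d Gd; rewrite /gproj subrK Gd.
Qed.

Lemma sdegs_uniq : uniq sdegs.
Proof. by rewrite map_inj_uniq ?gr_uniq //; apply: addIr. Qed.

Lemma gproj_id d e x : x \in sgr G e -> gproj d x = if d == e then x else 0.
Proof.
move=> xe; have [De|] := boolP (e \in sdegs); last first.
  rewrite mem_sdegs => /gr_out e0; move: xe; rewrite /sgr e0 memv0 => /eqP->.
  rewrite if_same; have := gproj_linear d (-1) 0 0.
  by rewrite scaler0 addr0 scaleN1r addNr.
have [Dd|D'd] := boolP (d \in sdegs); last first.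
  by rewrite gproj_out //; case: eqP D'd => // ->; rewrite De.
(* Two decompositions of [x] are compared: its projections, and [x] alone in degree [e]. The
   differences lie in the graded pieces and sum to 0, so independence kills each of them. *)
pose u f := gproj f x - if f == e then x else 0.
suff: u d = 0 by move/subr0_eq.
have /directv_sum_independent : directv (\sum_(i < size (gr_supp G)) gr G (gr_supp G)`_i).
  have := gr_direct G; rewrite !directvE /= (big_nth 0) big_mkord => /eqP->.
  by rewrite (big_nth 0) big_mkord.
move=> /(_ (fun i => u ((gr_supp G)`_i - 1))) h.
have lt_d : (index (d + 1)%R (gr_supp G) < size (gr_supp G))%N.
  by rewrite index_mem -mem_sdegs.
suff: u ((gr_supp G)`_(Ordinal lt_d) - 1) = 0.
  by rewrite /= nth_index -?mem_sdegs // addrK.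
apply: (h _ _ (Ordinal lt_d)) => // [i _|].
  rewrite /u; have := gproj_sgr ((gr_supp G)`_i - 1) x.
  rewrite /sgr subrK => Gi; apply: memvB => //; case: eqP => [ie|_].
    by move: xe; rewrite /sgr -ie subrK.
  exact: mem0v.
rewrite -(big_mkord xpredT (fun i => u ((gr_supp G)`_i - 1))).
rewrite -(big_nth 0 xpredT (fun f => u (f - 1))) -(big_map _ xpredT u) -/sdegs.
rewrite sumrB sum_gproj (bigD1_seq e) ?sdegs_uniq //= eqxx big1 ?addr0 ?subrr //.
by move=> f /negPf->.
Qed.

Lemma gprojK d e x : gproj d (gproj e x) = if d == e then gproj e x else 0.
Proof. exact/gproj_id/gproj_sgr. Qed.

Definition gdec : decomposition V := Decomposition sdegs_uniq
  gproj_linear gproj_out gprojK sum_gproj.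

Lemma mem_sgr d x : (x \in sgr G d) = (proj gdec d x == x).
Proof.
apply/idP/eqP => [/gproj_id E|<-]; first by rewrite /= E eqxx.
exact: gproj_sgr.
Qed.

Lemma sgrsE ds (s : seq V) : sgrs G ds s = homlist gdec ds s.
Proof. by elim: ds s => [|d ds IHds] [|x s] //=; rewrite IHds mem_sgr. Qed.

Lemma parE : par G = gpar gdec.
Proof.
apply/funext => q; apply/funext => x; rewrite /par /gpar /= big_map.
rewrite big_seq_cond [RHS]big_seq_cond; apply: eq_bigr => d /andP[Gd _].
by rewrite /gproj subrK Gd.
Qed.

Lemma passE : pass G = gsgn gdec.
Proof. by apply/funext => q; apply/funext => x; rewrite /pass parE. Qed.

(** Scalars sit in degree 0. Forms thereby become mappings with graded values, on which [gsgn] acts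
    trivially. *)
Definition kproj (d : int) (x : K^o) : K^o := if d == 0 then x else 0.

Lemma kproj_linear d (a : K) x y : kproj d (a *: x + y) = a *: kproj d x + kproj d y.
Proof. by rewrite /kproj; case: ifP; rewrite // scaler0 addr0. Qed.

Lemma kproj_out d x : d \notin [:: 0] -> kproj d x = 0.
Proof. by rewrite inE /kproj => /negPf->. Qed.

Lemma kprojK d e x : kproj d (kproj e x) = if d == e then kproj e x else 0.
Proof.
rewrite /kproj; case: eqP => [->|/eqP d0]; first by rewrite eq_sym; case: eqP.
by case: (eqVneq e 0) => [->|_]; rewrite ?(negPf d0) // if_same.
Qed.

Lemma sum_kproj x : \sum_(d <- [:: 0]) kproj d x = x.
Proof. by rewrite big_seq1. Qed.

Definition kdec : decomposition K^o := @Decomposition K K^o kproj [:: 0] isT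
  kproj_linear kproj_out kprojK sum_kproj.

Lemma gpar_kdec q (x : K^o) : gpar kdec q x = if q then 0 else x.
Proof. by rewrite /gpar big_mkcond big_seq1 /= /kproj; case: q. Qed.

Lemma gsgn_kdec q (x : K^o) : gsgn kdec q x = x.
Proof. by rewrite /gsgn !gpar_kdec scaler0 addr0. Qed.

Lemma mpartE q (Q : seq V -> V) : mpart G q Q = gpart gdec gdec q Q.
Proof. by apply/funext => s; rewrite /mpart /gpart parE /pars parE. Qed.

Lemma fpartE q (O : seq V -> K^o) : fpart G q O = gpart gdec kdec q O.
Proof.
apply/funext => s; rewrite /fpart /gpart big_mkcond; apply: eq_bigr => p _.
rewrite gpar_kdec /pars parE /psum addbC -negb_eqb.
by case: eqP.
Qed.

Lemma multimap_degreeE d : multimap_degree G d = homog gdec gdec d.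
Proof.
apply/funext => Q; apply/propext; split=> Qd ds s.
  by rewrite -sgrsE => /Qd; rewrite mem_sgr => /eqP.
by rewrite sgrsE => /Qd Qs; rewrite mem_sgr Qs.
Qed.

Lemma form_degreeE d : form_degree G d = homog gdec kdec d.
Proof.
apply/funext => O; apply/propext; split=> Od ds s.
  by rewrite -sgrsE => /Od; rewrite /= /kproj; case: eqP => // _ /(_ isT).
by rewrite sgrsE => /Od + /negPf h; rewrite /= /kproj h.
Qed.

End GradingDecomposition.

(** * The Lie algebra of multilinear maps *)

Section SplitsExchange.
Variables (T : Type) (W : nmodType).

Lemma splits_exchange (F : seq T -> seq T -> seq T -> seq T -> W) s t :
  splits (fun a b => splits (fun c d => F a b c d) t) s
  = splits (fun c d => splits (fun a b => F a b c d) s) t.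
Proof. by rewrite /splits exchange_big. Qed.

(** Two insertions into a third map, nested or disjoint, always cut the word into five blocks; this
    common shape makes the two sides of the associator comparable. *)
Definition splits5 (F : seq T -> seq T -> seq T -> seq T -> seq T -> W) s :=
  splits (fun a u => splits (fun b v => splits (fun c w =>
    splits (fun d e => F a b c d e) w) v) u) s.

End SplitsExchange.

Section Composition.
Variables (K : fieldType) (V : vectType K) (D : decomposition V).
Hypothesis nz2 : (2%:R : K) != 0.
Implicit Types (Q : seq V -> V) (s : seq V).
Notation sg := (gsgn D).
Notation parity_of := (has_parity D D).

(** [mcomp] in terms of cuts: [b] is fed to [Q'], and [Q'], of parity [q], jumps over [a]. *)
Definition gcomp (q : bool) Q Q' : seq V -> V := fun s =>
  splits (fun a u => splits (fun b c => Q (map (sg q) a ++ Q' b :: c)) u) s.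

Lemma map_sg_addb p q s : map (sg p) (map (sg q) s) = map (sg (p (+) q)) s.
Proof. by rewrite -map_comp; apply: eq_map => x; apply: gsgn_addb. Qed.

Lemma gcomp_multilinear q Q Q' : multilinear Q -> multilinear Q' ->
  multilinear (gcomp q Q Q').
Proof.
move=> Ql Q'l; apply: multilinear_splits => [u|a].
  apply: (@multilinear_splits_param K V V
    (fun a b c => Q (map (sg q) a ++ Q' b :: c)) u) => b c s t k x y.
  by rewrite !map_cat -!catA /= linearP Ql.
apply: multilinear_splits => [c s t k x y|b s t k x y]; first by rewrite Q'l Ql.
by rewrite -!cat_cons !catA Ql.
Qed.

Lemma gcomp_polylinear q Q Q' : polylinear Q -> polylinear Q' ->
  polylinear (gcomp q Q Q').
Proof.
case=> Ql [N QN] [Q'l [M Q'M]]; split; first exact: gcomp_multilinear.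
exists (N + M)%N => s sNM.
apply: (splits_ind (P := fun x => x = 0)) => // [x y -> ->|a u su].
  by rewrite addr0.
apply: (splits_ind (P := fun x => x = 0)) => // [x y -> ->|b c uE].
  by rewrite addr0.
have [bM|Mb] := leqP (size b) M; last by rewrite Q'M // multilinear0.
apply: QN; move: sNM; rewrite su uE !size_cat size_map /=; lia.
Qed.

Lemma gcomp_combl q k Q1 Q2 Q :
  gcomp q (k *: Q1 + Q2) Q = k *: gcomp q Q1 Q + gcomp q Q2 Q.
Proof.
apply/funext => s; rewrite !fctE /gcomp /splits scaler_sumr -big_split.
apply: eq_bigr => i _ /=; rewrite scaler_sumr -big_split.
by apply: eq_bigr.
Qed.

Lemma gcomp_combr q k Q Q1 Q2 : multilinear Q ->
  gcomp q Q (k *: Q1 + Q2) = k *: gcomp q Q Q1 + gcomp q Q Q2.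
Proof.
move=> Ql; apply/funext => s; rewrite !fctE /gcomp /splits scaler_sumr -big_split.
apply: eq_bigr => i _ /=; rewrite scaler_sumr -big_split.
by apply: eq_bigr => j _; rewrite Ql.
Qed.

Lemma gcomp_parity p q Q Q' : multilinear Q -> parity_of p Q -> parity_of q Q' ->
  parity_of (p (+) q) (gcomp q Q Q').
Proof.
move=> Ql Qp Q'q r s; rewrite /gcomp splits_map.
rewrite (raddf_splits _ _ (linear0 (sg r)) (linearD (sg r))).
rewrite (raddf_splits _ _ (scaler0 _ _) (scalerDr _)).
apply: eq_splits => a u _; rewrite splits_map.
rewrite (raddf_splits _ _ (linear0 (sg r)) (linearD (sg r))).
rewrite (raddf_splits _ _ (scaler0 _ _) (scalerDr _)).
apply: eq_splits => b c _; rewrite Q'q map_sg_addb addbC -map_sg_addb.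
rewrite multilinearZ // -[sg r (Q' b) :: _]/(map (sg r) (Q' b :: c)) -map_cat Qp.
by rewrite scalerA -signr_addb addbC andb_addl.
Qed.

Lemma gcomp_homog d e q Q Q' : multilinear Q ->
  homog D D d Q -> homog D D e Q' -> homog D D (d + e) (gcomp q Q Q').
Proof.
move=> Ql Qd Q'e ds s hs.
set n := d + e + _; pose P x := proj D n x = x.
have P0 : P 0 by apply: linear0.
have PD x y : P x -> P y -> P (x + y) by rewrite /P linearD /= => -> ->.
apply: (splits_ind (P := P)) => // a u su.
apply: (splits_ind (P := P)) => // b c uE; rewrite /P /n.
move: hs; rewrite su uE => /homlist_cat[da [du [-> ha]]].
move=> /homlist_cat[db [dc [-> hb hc]]].
have := Qd (da ++ (e + \sum_(i <- db) i) :: dc) (map (sg q) a ++ Q' b :: c).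
rewrite !big_cat big_cons /=; set x := d + _; set y := d + e + _.
have -> : x = y by rewrite /x /y; ring.
apply; apply: cat_homlist; first exact: gsgn_homlist.
by rewrite /homlist /= Q'e // eqxx.
Qed.

Section PreLie.
Variables (Q1 Q2 Q3 : seq V -> V) (q2 q3 : bool).
Hypotheses (Q1l : multilinear Q1) (Q2l : multilinear Q2).

(** The insertions with [Q2] to the left of [Q3]: both maps jump over [a], while only [Q3] jumps
    over [b] and [c]. *)
Definition gcomp_disjoint s := splits5 (fun a b c d e =>
  Q1 (map (sg (q2 (+) q3)) a
      ++ Q2 (map (sg q3) b) :: map (sg q3) c ++ Q3 d :: e)) s.

Lemma gcomp_nested s : gcomp (q2 (+) q3) Q1 (gcomp q3 Q2 Q3) s =
  splits5 (fun a b c d e => Q1 (map (sg (q2 (+) q3)) a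
      ++ Q2 (map (sg q3) b ++ Q3 c :: d) :: e)) s.
Proof.
apply: eq_splits => a v _.
pose f a e x := Q1 (map (sg (q2 (+) q3)) a ++ x :: e).
have f0 e : f a e 0 = 0 by apply: multilinear0.
have fD e : {morph f a e : x y / x + y} by move=> x y; apply: multilinearD.
transitivity (splits (fun w e => splits (fun b u => splits (fun c d =>
    f a e (Q2 (map (sg q3) b ++ Q3 c :: d))) u) w) v).
  apply: eq_splits => w e _; rewrite -/(f a e _).
  rewrite (raddf_splits _ _ (f0 e) (fD e)); apply: eq_splits => b u _.
  by rewrite (raddf_splits _ _ (f0 e) (fD e)).
rewrite splits_assoc; apply: eq_splits => b w _.
by rewrite splits_assoc.
Qed.

(** The value of [Q3] may fall among the arguments of [Q2], to the right of [Q2] or to its left: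
    these are the three terms, in this order. In the last one [Q2] jumps over that value, whence
    [sg q2 (Q3 b)]. *)
Lemma gcomp_compl s : gcomp q3 (gcomp q2 Q1 Q2) Q3 s =
  gcomp (q2 (+) q3) Q1 (gcomp q3 Q2 Q3) s + gcomp_disjoint s
  + splits5 (fun a b c d e =>
      Q1 (map (sg (q2 (+) q3)) a
          ++ sg q2 (Q3 b) :: map (sg q2) c ++ Q2 d :: e)) s.
Proof.
rewrite gcomp_nested {1}/gcomp.
(* [splits_cat_cons] is applied twice, at the cut before the argument block of [Q2] and at the cut
   after it. *)
under eq_splits => a u _ do under eq_splits => b c _ do
  rewrite {1}/gcomp splits_cat_cons splits_map
    (eq_splits (fun _ _ _ => splits_cat_cons _ _ _ _)) splitsD.
rewrite -splitsD.
under eq_splits => a u _ do rewrite !splitsD.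
rewrite !splitsD; congr (_ + _); last first.
  apply: eq_splits => a u _; apply: eq_splits => b c _; apply: eq_splits => c1 c2 _.
  by apply: eq_splits => d e _; rewrite map_cat /= map_sg_addb -catA.
rewrite addrC; congr (_ + _).
  under eq_splits do rewrite splits_exchange.
  rewrite splits_assoc; apply: eq_splits => a v _; apply: eq_splits => b w _.
  apply: eq_splits => c x _; apply: eq_splits => d e _.
  by rewrite map_sg_addb.
under eq_splits do rewrite splits_exchange.
rewrite splits_assoc; apply: eq_splits => a v _.
under eq_splits => b1 u _.
  under eq_splits do rewrite splits_map.
  rewrite splits_exchange; over.
rewrite splits_assoc; apply: eq_splits => b w _; apply: eq_splits => c x _.
by apply: eq_splits => d e _; rewrite map_sg_addb.
Qed.

(** Moving [sg q2] from the value of [Q3] to its arguments costs exactly the exchange sign; what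
    remains is [gcomp_disjoint] with the roles of [Q2] and [Q3] swapped. *)
Lemma gcomp_disjointC s : has_parity D D q3 Q3 ->
  splits5 (fun a b c d e => Q1 (map (sg (q2 (+) q3)) a
    ++ sg q2 (Q3 b) :: map (sg q2) c ++ Q2 d :: e)) s
  = (-1) ^+ (q2 && q3) *: splits5 (fun a b c d e => Q1 (map (sg (q3 (+) q2)) a
    ++ Q3 (map (sg q2) b) :: map (sg q2) c ++ Q2 d :: e)) s.
Proof.
move=> Q3q; rewrite /splits5.
rewrite (raddf_splits _ _ (scaler0 _ _) (scalerDr _)); apply: eq_splits => a u _.
rewrite (raddf_splits _ _ (scaler0 _ _) (scalerDr _)); apply: eq_splits => b v _.
rewrite (raddf_splits _ _ (scaler0 _ _) (scalerDr _)); apply: eq_splits => c w _.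
rewrite (raddf_splits _ _ (scaler0 _ _) (scalerDr _)); apply: eq_splits => d e _.
rewrite Q3q multilinearZ // scalerA -signr_addb andbC addbb scale1r.
by rewrite addbC.
Qed.

End PreLie.

Lemma pre_Lie q2 q3 Q1 Q2 Q3 : multilinear Q1 -> multilinear Q2 -> multilinear Q3 ->
  parity_of q2 Q2 -> parity_of q3 Q3 ->
  gcomp q3 (gcomp q2 Q1 Q2) Q3 - gcomp (q2 (+) q3) Q1 (gcomp q3 Q2 Q3)
  = (-1) ^+ (q2 && q3) *:
    (gcomp q2 (gcomp q3 Q1 Q3) Q2 - gcomp (q2 (+) q3) Q1 (gcomp q2 Q3 Q2)).
Proof.
move=> Q1l Q2l Q3l Q2q Q3q; apply/funext => s; rewrite !fctE.
rewrite [in RHS](addbC q2 q3) !gcomp_compl //.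
have E (x y z : V) : x + y + z - x = y + z by rewrite addrC !addrA addNr add0r.
rewrite !E (@gcomp_disjointC Q1 Q2 Q3) // (@gcomp_disjointC Q1 Q3 Q2) //.
rewrite scalerDr scalerA -signr_addb [q3 && q2]andbC addbb scale1r.
by rewrite addrC.
Qed.

(** Turns identities in [V] into scalar identities, to which [ring] applies. *)
Lemma linear_functional_ext (v w : V) :
  (forall f : {linear V -> K^o}, f v = f w) -> v = w.
Proof.
move=> eqf; rewrite (coord_vbasis (memvf v)) (coord_vbasis (memvf w)).
by apply: eq_bigr => i _; rewrite (eqf (coord (vbasis fullv) i)).
Qed.

Definition cbr p q Q Q' := gcomp q Q Q' - (-1) ^+ (p && q) *: gcomp p Q' Q.

Lemma gcomp_subl q k Q1 Q2 Q :
  gcomp q (Q1 - k *: Q2) Q = gcomp q Q1 Q - k *: gcomp q Q2 Q.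
Proof. by rewrite addrC -scaleNr gcomp_combl scaleNr addrC. Qed.

Lemma gcomp_subr q k Q Q1 Q2 : multilinear Q ->
  gcomp q Q (Q1 - k *: Q2) = gcomp q Q Q1 - k *: gcomp q Q Q2.
Proof. by move=> Ql; rewrite addrC -scaleNr gcomp_combr // scaleNr addrC. Qed.

Lemma cbr_jacobi p q r Q1 Q2 Q3 :
  multilinear Q1 -> multilinear Q2 -> multilinear Q3 ->
  parity_of p Q1 -> parity_of q Q2 -> parity_of r Q3 ->
  cbr p (q (+) r) Q1 (cbr q r Q2 Q3) = cbr (p (+) q) r (cbr p q Q1 Q2) Q3
    + (-1) ^+ (p && q) *: cbr q (p (+) r) Q2 (cbr p r Q1 Q3).
Proof.
move=> l1 l2 l3 p1 p2 p3.
have P123 := pre_Lie l1 l2 l3 p2 p3.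
have P213 := pre_Lie l2 l1 l3 p1 p3.
have P312 := pre_Lie l3 l1 l2 p1 p2.
rewrite /cbr !gcomp_subl !gcomp_subr //.
apply/funext => s; apply: linear_functional_ext => f.
have {}P123 := congr1 (fun Q => f (Q s)) P123.
have {}P213 := congr1 (fun Q => f (Q s)) P213.
have {}P312 := congr1 (fun Q => f (Q s)) P312.
move: P123 P213 P312; rewrite !fctE !(linearB, linearD, linearZ) /=.
(* Expanding the three double brackets gives twelve composites. Each pre-Lie identity eliminates
   one, and the remaining nine are treated as independent scalars. *)
do 3![move/eqP; rewrite subr_eq => /eqP->].
do 9![move: (f _) => ?].
by case: p q r {p1 p2 p3} => [] [] []; rewrite ?scaleN1r ?scale1r /=; ring.
Qed.

End Composition.

Section LieAlgebra.
Variables (K : fieldType) (V : vectType K) (D : decomposition V).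
Hypothesis nz2 : (2%:R : K) != 0.
Implicit Types (Q : seq V -> V) (s : seq V).
Notation parity_of := (has_parity D D).
Notation part := (gpart D D).

Definition gbr Q Q' : seq V -> V :=
  \sum_(p : bool) \sum_(q : bool) cbr D p q (part p Q) (part q Q').

Lemma cbr_combl p q k Q1 Q2 Q : multilinear Q ->
  cbr D p q (k *: Q1 + Q2) Q = k *: cbr D p q Q1 Q + cbr D p q Q2 Q.
Proof.
move=> Ql; rewrite /cbr gcomp_combl gcomp_combr // !scalerDr scalerN !scalerA.
by rewrite [_ * k]mulrC opprD addrACA.
Qed.

Lemma cbr_combr p q k Q Q1 Q2 : multilinear Q ->
  cbr D p q Q (k *: Q1 + Q2) = k *: cbr D p q Q Q1 + cbr D p q Q Q2.
Proof.
move=> Ql; rewrite /cbr gcomp_combl gcomp_combr // !scalerDr scalerN !scalerA.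
by rewrite [_ * k]mulrC opprD addrACA.
Qed.

Lemma cbr0l p q Q : multilinear Q -> cbr D p q 0 Q = 0.
Proof.
by move=> /(@cbr_combl p q (-1) 0 0); rewrite scaler0 addr0 scaleN1r addNr.
Qed.

Lemma cbr0r p q Q : multilinear Q -> cbr D p q Q 0 = 0.
Proof.
by move=> /(@cbr_combr p q (-1) Q 0 0); rewrite scaler0 addr0 scaleN1r addNr.
Qed.

Lemma gbr_combl k Q1 Q2 Q : multilinear Q1 -> multilinear Q2 -> multilinear Q ->
  gbr (k *: Q1 + Q2) Q = k *: gbr Q1 Q + gbr Q2 Q.
Proof.
move=> l1 l2 l; rewrite /gbr scaler_sumr -big_split; apply: eq_bigr => p _ /=.
rewrite scaler_sumr -big_split; apply: eq_bigr => q _ /=.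
by rewrite gpart_comb // cbr_combl //; apply: gpart_multilinear.
Qed.

Lemma gbr_combr k Q Q1 Q2 : multilinear Q1 -> multilinear Q2 -> multilinear Q ->
  gbr Q (k *: Q1 + Q2) = k *: gbr Q Q1 + gbr Q Q2.
Proof.
move=> l1 l2 l; rewrite /gbr scaler_sumr -big_split; apply: eq_bigr => p _ /=.
rewrite scaler_sumr -big_split; apply: eq_bigr => q _ /=.
by rewrite gpart_comb // cbr_combr //; apply: gpart_multilinear.
Qed.

Lemma gbr_parity p q Q Q' : multilinear Q -> multilinear Q' ->
  parity_of p Q -> parity_of q Q' -> gbr Q Q' = cbr D p q Q Q'.
Proof.
move=> l l' Qp Q'q; rewrite /gbr (bigD1 p) //= (bigD1 q) //=.
rewrite !(gpart_id nz2 _ l Qp) !(gpart_id nz2 _ l' Q'q) !eqxx.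
rewrite big1 => [|r /negPf rq]; last first.
  by rewrite (gpart_id nz2 _ l' Q'q) eq_sym rq cbr0r.
rewrite addr0 big1 ?addr0 // => r /negPf rp; rewrite big1 // => t _.
rewrite (gpart_id nz2 _ l Qp) eq_sym rp cbr0l //.
exact: gpart_multilinear.
Qed.

Lemma cbr_polylinear p q Q Q' : polylinear Q -> polylinear Q' ->
  polylinear (cbr D p q Q Q').
Proof.
move=> Qp Q'p; rewrite /cbr addrC -scaleNr.
by apply: (polylinear_subspace V V).2; apply: gcomp_polylinear.
Qed.

Lemma gpart_polylinear q Q : polylinear Q -> polylinear (part q Q).
Proof.
case=> Ql [N QN]; split; first exact: gpart_multilinear.
exists N => s sN; rewrite gpartE // !fctE !QN ?size_map // linear0.
by rewrite scaler0 addr0 scaler0.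
Qed.

Lemma gbr_polylinear Q Q' : polylinear Q -> polylinear Q' ->
  polylinear (gbr Q Q').
Proof.
move=> Qp Q'p; have sp := polylinear_subspace V V.
apply: subspace_sum => // p; apply: subspace_sum => // q.
by apply: cbr_polylinear; apply: gpart_polylinear.
Qed.

Lemma cbr_homog d e p q Q Q' : multilinear Q -> multilinear Q' ->
  homog D D d Q -> homog D D e Q' -> homog D D (d + e) (cbr D p q Q Q').
Proof.
move=> Ql Q'l Qd Q'e; rewrite /cbr [X in homog _ _ _ X]addrC -scaleNr.
have [_ HP] := homog_subspace D D (d + e); apply: HP; last exact: gcomp_homog.
by rewrite addrC; apply: gcomp_homog.
Qed.

(** The sign involves only the first two maps, so [Q3] needs no parity: it is split into its parts
    and the identity is linear in it. *)
Lemma gbr_jacobi p q Q1 Q2 Q3 :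
  multilinear Q1 -> multilinear Q2 -> polylinear Q3 ->
  parity_of p Q1 -> parity_of q Q2 -> polylinear Q1 -> polylinear Q2 ->
  gbr Q1 (gbr Q2 Q3)
  = gbr (gbr Q1 Q2) Q3 + (-1) ^+ (p && q) *: gbr Q2 (gbr Q1 Q3).
Proof.
move=> l1 l2 l3p p1 p2 pl1 pl2; have [l3 _] := l3p.
have lp r : multilinear (part r Q3) by apply: gpart_multilinear.
have par3 r : parity_of r (part r Q3) by apply: gpart_parity.
have brl Q Q' : polylinear Q -> polylinear Q' -> multilinear (gbr Q Q').
  by move=> ? ?; case: (@gbr_polylinear Q Q').
have E r : gbr Q1 (gbr Q2 (part r Q3)) = gbr (gbr Q1 Q2) (part r Q3)
    + (-1) ^+ (p && q) *: gbr Q2 (gbr Q1 (part r Q3)).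
  have cl u v Q Q' : multilinear Q -> multilinear Q' -> multilinear (cbr D u v Q Q').
    move=> ? ?; rewrite /cbr addrC -scaleNr.
    by apply: multilinear_comb; apply: gcomp_multilinear.
  have cp u v Q Q' : multilinear Q -> multilinear Q' ->
    parity_of u Q -> parity_of v Q' -> parity_of (u (+) v) (cbr D u v Q Q').
    move=> ? ? ? ?; rewrite /cbr addrC -scaleNr.
    apply: has_parity_comb; last exact: gcomp_parity.
    by rewrite addbC; apply: gcomp_parity.
  rewrite (gbr_parity l2 (lp r) p2 (par3 r)) (gbr_parity l1 (lp r) p1 (par3 r)).
  rewrite (gbr_parity l1 l2 p1 p2) (@gbr_parity p (q (+) r)) //; try by auto.
  rewrite (@gbr_parity (p (+) q) r) //; try by auto.
  rewrite (@gbr_parity q (p (+) r)) //; try by auto.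
  exact: cbr_jacobi.
have E3 : Q3 = 1 *: part true Q3 + part false Q3.
  by rewrite scale1r {1}(sum_gpart D D l3) big_bool.
have lbr Q r : polylinear Q -> multilinear (gbr Q (part r Q3)).
  by move=> ?; apply: brl => //; apply: gpart_polylinear.
rewrite E3 !gbr_combr //; try by auto.
by rewrite !scale1r !E scalerDr addrACA.
Qed.

End LieAlgebra.

Section MultimapLie.
Variables (K : fieldType) (V : vectType K) (G : grading V).
Hypothesis nz2 : (2%:R : K) != 0.

Lemma mcompE q : mcomp G q = gcomp (gdec G) q.
Proof.
apply/funext => Q; apply/funext => Q'; apply/funext => s.
apply: eq_bigr => i _; rewrite /splits size_drop; apply: eq_bigr => j _.
by rewrite drop_drop addnC passE.
Qed.

Lemma mbracketE : mbracket G = gbr (gdec G).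
Proof.
apply/funext => Q; apply/funext => Q'.
apply: eq_bigr => p _; apply: eq_bigr => q _.
by rewrite !mcompE !mpartE.
Qed.

Lemma signz_parity d e : (-1) ^ (d * e) = (-1) ^+ (parity d && parity e) :> K.
Proof.
have -> : (-1) ^ (d * e) = (-1) ^+ `|(d * e)%R|%N :> K.
  by case: (d * e) => n //; rewrite NegzE -exprz_inv invrN invr1.
by rewrite -signr_odd abszM oddM.
Qed.

(** Constant maps, of arity 0, are kept here; [multimaps] is cut out of this algebra afterwards by
    vanishing on the empty word. *)
Lemma polylinear_Lie :
  graded_Lie_algebra (@polylinear K V V) (multimap_degree G) (mbracket G).
Proof.
have -> : multimap_degree G = homog (gdec G) (gdec G).
  by apply/funext => d; rewrite multimap_degreeE.
rewrite mbracketE; split.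
- exact: polylinear_graded.
- by move=> Q Q'; apply: gbr_polylinear.
- by move=> a Q1 Q2 Q3 [l1 _] [l2 _] [l3 _]; apply: gbr_combl.
- by move=> a Q1 Q2 Q3 [l1 _] [l2 _] [l3 _]; apply: gbr_combr.
- move=> d e Q1 Q2 [l1 _] [l2 _] h1 h2.
  have p1 := homog_parity l1 h1; have p2 := homog_parity l2 h2.
  by rewrite (gbr_parity nz2 l1 l2 p1 p2); apply: cbr_homog.
- move=> d e Q1 Q2 [l1 _] [l2 _] h1 h2.
  have p1 := homog_parity l1 h1; have p2 := homog_parity l2 h2.
  rewrite (gbr_parity nz2 l1 l2 p1 p2) (gbr_parity nz2 l2 l1 p2 p1) /cbr.
  rewrite signz_parity andbC scalerBr scalerA -signr_addb addbb scale1r.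
  by rewrite opprB.
- move=> d e Q1 Q2 Q3 P1 P2 P3 h1 h2; have [l1 _] := P1; have [l2 _] := P2.
  have p1 := homog_parity l1 h1; have p2 := homog_parity l2 h2.
  by rewrite signz_parity; apply: gbr_jacobi.
Qed.

End MultimapLie.

(** * Cyclic forms *)

Section Rotation.
Variables (K : fieldType) (V : vectType K) (G : grading V).
Hypothesis nz2 : (2%:R : K) != 0.
Implicit Types (O : seq V -> K^o) (s t : seq V).
Notation D := (gdec G).
Notation sg := (gsgn (gdec G)).
Notation parity_of := (has_parity (gdec G) (kdec K)).
Notation part := (gpart (gdec G) (kdec K)).

Lemma form_parityE p O r s : parity_of p O ->
  O (map (sg r) s) = (-1) ^+ (p && r) *: O s.
Proof. by move=> ->; rewrite gsgn_kdec. Qed.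

Lemma rotate_rcons O t y :
  rotate G O (rcons t y) = \sum_p O (gpar D p y :: map (sg p) t).
Proof.
have -> : rcons t y = head y t :: behead (rcons t y) by case: t.
rewrite /rotate; apply: eq_bigr => p _; rewrite parE passE.
by case: t => //= x t; rewrite last_rcons belast_rcons.
Qed.

Lemma rotate_comb k O O' :
  rotate G (k *: O + O') = k *: rotate G O + rotate G O'.
Proof.
apply/funext; case/lastP => [//|t y]; rewrite !fctE !rotate_rcons.
by rewrite scaler_sumr -big_split.
Qed.

(** Where [O] does not vanish the letters have total parity [p], so [t] has parity $p+\deg y$. The
    jump of [y] over [t] has the sign exponent $\deg y\,(p+\deg y) \equiv (p+1)\deg y$, which
    depends on [y] alone. *)
Lemma rotate_parity p O t y : multilinear O -> parity_of p O ->
  rotate G O (rcons t y) = O (sg (~~ p) y :: t).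
Proof.
move=> Ol Op; rewrite rotate_rcons big_bool /=.
have -> : gpar D true y :: map (sg true) t
        = map (sg true) (sg true (gpar D true y) :: t) by rewrite /= gsgnK.
rewrite (form_parityE _ _ Op) andbT gsgn_gpar (eq_map (gsgn_false D)) map_id.
have Z a x : O (a *: x :: t) = a *: O (x :: t) by apply: (multilinearZ [::]).
rewrite /gsgn [RHS](multilinearD [::]) // !Z scalerA -signr_addb addrC.
by rewrite addbT.
Qed.

Lemma rotate_parity_multilinear p O : multilinear O -> parity_of p O ->
  multilinear (rotate G O).
Proof.
move=> Ol Op s t a x y; case/lastP: t => [|t z].
  by rewrite !cats1 !(rotate_parity _ _ Ol Op) linearP; apply: (Ol [::]).
rewrite -!rcons_cons -!rcons_cat !(rotate_parity _ _ Ol Op).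
by rewrite -!cat_cons Ol.
Qed.

Lemma rotate_has_parity p O : multilinear O -> parity_of p O ->
  parity_of p (rotate G O).
Proof.
move=> Ol Op r s; rewrite gsgn_kdec; case/lastP: s => [|s z].
  exact: (form_parityE r [::] Op).
rewrite map_rcons !(rotate_parity _ _ Ol Op) gsgn_addb addbC -gsgn_addb.
by rewrite -(form_parityE _ _ Op).
Qed.

Lemma rotate_sum O : multilinear O -> rotate G O = \sum_q rotate G (part q O).
Proof.
move=> Ol; rewrite {1}(sum_gpart D (kdec K) Ol) !big_bool /=.
by have := rotate_comb 1 (part true O) (part false O); rewrite !scale1r.
Qed.

Lemma rotate_multilinear O : multilinear O -> multilinear (rotate G O).
Proof.
move=> Ol; rewrite rotate_sum // big_bool /= -[rotate G (part true O)]scale1r.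
by apply: multilinear_comb; apply: rotate_parity_multilinear;
  (apply: gpart_multilinear || apply: gpart_parity).
Qed.

Lemma rotate_gpart q O : multilinear O ->
  rotate G (part q O) = part q (rotate G O).
Proof.
move=> Ol; rewrite [in RHS]rotate_sum // big_bool /= -[rotate G (part true O)]scale1r.
have pl r : multilinear (part r O) by apply: gpart_multilinear.
have pp r : parity_of r (part r O) by apply: gpart_parity.
have rl r : multilinear (rotate G (part r O)) by apply: rotate_multilinear.
have rp r : parity_of r (rotate G (part r O)) by apply: rotate_has_parity.
rewrite gpart_comb // !(gpart_id nz2 _ (rl _) (rp _)) scale1r.
by case: q; rewrite ?addr0 ?add0r.
Qed.

Lemma rotate_polylinear O : polylinear O -> polylinear (rotate G O).
Proof.
case=> Ol [N ON]; split; first exact: rotate_multilinear.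
exists N; case/lastP => [|t y] tN; first exact: ON.
rewrite rotate_rcons big1 // => p _; apply: ON.
by rewrite /= size_map; rewrite size_rcons in tN.
Qed.

Lemma rotate_homog d O : multilinear O -> homog D (kdec K) d O ->
  homog D (kdec K) d (rotate G O).
Proof.
move=> Ol Od ds s; case/lastP: s => [|t y]; first exact: Od.
rewrite -cats1 => /homlist_cat[dt [dy [-> ht hy]]]; rewrite cats1.
rewrite (rotate_parity _ _ Ol (homog_parity Ol Od)) big_cat addrC [X in X + d]addrC.
rewrite -big_cat addrC; apply: Od; rewrite -cat1s; apply: cat_homlist => //.
exact: (gsgn_homlist _ hy).
Qed.

Lemma iter_rotate p O u v : multilinear O -> parity_of p O ->
  iter (size v) (rotate G) O (u ++ v) = O (map (sg (~~ p)) v ++ u).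
Proof.
elim: v u O => [|y v IHv] u O Ol Op; first by rewrite cats0.
rewrite [size _]/= iterSr -cat_rcons IHv; first last.
- exact: rotate_has_parity.
- exact: rotate_multilinear.
by rewrite -rcons_cat (rotate_parity _ _ Ol Op).
Qed.

Lemma cyclic_cat p O a c : multilinear O -> parity_of p O -> rotate G O = O ->
  O (a ++ c) = O (map (sg (~~ p)) c ++ a).
Proof.
move=> Ol Op Oc; rewrite -(iter_rotate _ _ Ol Op).
suff it n : iter n (rotate G) O = O by rewrite it.
by elim: n => //= n ->.
Qed.

Lemma iter_rotate_comb j k O O' :
  iter j (rotate G) (k *: O + O')
  = k *: iter j (rotate G) O + iter j (rotate G) O'.
Proof. by elim: j => //= j ->; rewrite rotate_comb. Qed.

Lemma Cycl_comb k O O' : Cycl G (k *: O + O') = k *: Cycl G O + Cycl G O'.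
Proof.
apply/funext => s; rewrite !fctE /Cycl scaler_sumr -big_split.
by apply: eq_bigr => j _ /=; rewrite iter_rotate_comb.
Qed.

(** A full turn has the sign exponent $p(p+1)$, which is even, so rotations may be counted from 1 to
    [n] instead of from 0 to [n - 1]. Each of them then moves the last letter [y]. *)
Lemma Cycl_rcons p O t y : multilinear O -> parity_of p O ->
  Cycl G O (rcons t y) = \sum_(j < size (rcons t y)) iter j.+1 (rotate G) O (rcons t y).
Proof.
move=> Ol Op; rewrite /Cycl size_rcons maxnE subn1 add1n /=.
rewrite big_ord_recl [RHS]big_ord_recr addrC; congr (_ + _).
have := iter_rotate [::] (rcons t y) Ol Op; rewrite cat0s cats0 size_rcons.
by rewrite (form_parityE _ _ Op) andbN scale1r => /esym.
Qed.

Lemma rotate_Cycl O : multilinear O -> rotate G (Cycl G O) = Cycl G O.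
Proof.
have main p F : multilinear F -> parity_of p F -> rotate G (Cycl G F) = Cycl G F.
  move=> Fl Fp; apply/funext; case/lastP => [//|t y].
  rewrite rotate_rcons (Cycl_rcons _ _ Fl Fp) size_rcons.
  under eq_bigr => q _ do rewrite /Cycl /= size_map maxnE subn1 add1n /=.
  by rewrite exchange_big; apply: eq_bigr => j _; rewrite /= rotate_rcons.
move=> Ol; rewrite {1 2}(sum_gpart D (kdec K) Ol) big_bool /= -[part true O]scale1r.
by rewrite Cycl_comb rotate_comb !(main _ _ (gpart_multilinear nz2 _ _ _ Ol)
  (gpart_parity _ _ _ Ol)).
Qed.

(** A rotation by $j+1$ brings [y] and the last $j$ letters of [t] to the front, so rotations
    correspond to cuts of [t]; the cut position decreases with $j$, whence the reversal of the
    index. *)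
Lemma Cycl_splits p O t y : multilinear O -> parity_of p O ->
  Cycl G O (rcons t y) =
  splits (fun u v => O (map (sg (~~ p)) (rcons v y) ++ u)) t.
Proof.
move=> Ol Op; rewrite (Cycl_rcons _ _ Ol Op) size_rcons /splits.
rewrite (reindex_inj rev_ord_inj) /=; apply: eq_bigr => i _.
rewrite -(iter_rotate _ _ Ol Op) -rcons_cat cat_take_drop size_rcons size_drop.
by rewrite subSS.
Qed.

End Rotation.

(** * The symplectic form and the forms $\Omega_Q$ *)

Section Symplectic.
Variables (K : fieldType) (V : vectType K) (G : grading V) (b : {biscalar V}).
Hypothesis nz2 : (2%:R : K) != 0.
Hypothesis b_deg0 : form_of_degree0 G b.
Hypothesis b_sym : graded_symmetric G b.
Hypothesis b_nondeg : nondegenerate_form b.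
Notation D := (gdec G).
Notation sg := (gsgn (gdec G)).
Notation B := (symplectic_form G b).

Lemma B_linearl a u v w : B (a *: u + v) w = a * B u w + B v w.
Proof. by rewrite /symplectic_form passE linearP linearPl. Qed.

Lemma B_linearr a u v w : B w (a *: u + v) = a * B w u + B w v.
Proof. by rewrite /symplectic_form linearPr. Qed.

Lemma B_Dl u v w : B (u + v) w = B u w + B v w.
Proof. by rewrite -[u]scale1r B_linearl mul1r !scale1r. Qed.

Lemma B_Dr u v w : B w (u + v) = B w u + B w v.
Proof. by rewrite -[u]scale1r B_linearr mul1r !scale1r. Qed.

Lemma B_0l w : B 0 w = 0.
Proof. by rewrite /symplectic_form passE linear0 linear0l. Qed.

Lemma B_0r w : B w 0 = 0.
Proof. by rewrite /symplectic_form linear0r. Qed.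

Lemma B_Zl a u w : B (a *: u) w = a * B u w.
Proof. by rewrite -[a *: u]addr0 B_linearl B_0l addr0. Qed.

Lemma B_Zr a u w : B w (a *: u) = a * B w u.
Proof. by rewrite -[a *: u]addr0 B_linearr B_0r addr0. Qed.

Lemma B_suml (I : Type) (r : seq I) (P : pred I) f w :
  B (\sum_(i <- r | P i) f i) w = \sum_(i <- r | P i) B (f i) w.
Proof. by apply: (big_morph (B^~ w)); [move=> x y; apply: B_Dl | apply: B_0l]. Qed.

Lemma B_sumr (I : Type) (r : seq I) (P : pred I) f w :
  B w (\sum_(i <- r | P i) f i) = \sum_(i <- r | P i) B w (f i).
Proof. by apply: (big_morph (B w)); [move=> x y; apply: B_Dr | apply: B_0r]. Qed.

(** The constant 2 is the shift of both arguments: $|u|+|v| = d+e+2$, and [b] has degree 0. *)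
Lemma B_degree d e u v : proj D d u = u -> proj D e v = v ->
  d + e + 2 != 0 -> B u v = 0.
Proof.
move=> du ev de; rewrite /symplectic_form passE (gsgn_hom _ du) linearZl_LR /=.
rewrite (b_deg0 (d := d + 1) (e := e + 1)) ?mulr0 //.
- by have := mem_sgr G d u; rewrite du eqxx.
- by have := mem_sgr G e v; rewrite ev eqxx.
- by rewrite addrACA.
Qed.

Lemma bilinear_hom_ext (f g : V -> V -> K) :
  (forall a u v w, f (a *: u + v) w = a * f u w + f v w) ->
  (forall a u v w, f w (a *: u + v) = a * f w u + f w v) ->
  (forall a u v w, g (a *: u + v) w = a * g u w + g v w) ->
  (forall a u v w, g w (a *: u + v) = a * g w u + g w v) ->
  (forall d e u v, proj D d u = u -> proj D e v = v -> f u v = g u v) ->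
  forall u v, f u v = g u v.
Proof.
have exp (h : V -> V -> K) :
    (forall a u v w, h (a *: u + v) w = a * h u w + h v w) ->
    (forall a u v w, h w (a *: u + v) = a * h w u + h w v) -> forall u v,
    h u v = \sum_(d <- degs D) \sum_(e <- degs D) h (proj D d u) (proj D e v).
  move=> hl hr u v.
  have hD x y z : h (x + y) z = h x z + h y z.
    by rewrite -[x]scale1r hl mul1r scale1r.
  have h0 z : h 0 z = 0.
    by have := hl (-1) 0 0 z; rewrite scaler0 addr0 mulN1r addNr.
  have hD' x y z : h z (x + y) = h z x + h z y.
    by rewrite -[x]scale1r hr mul1r scale1r.
  have h0' z : h z 0 = 0.
    by have := hr (-1) 0 0 z; rewrite scaler0 addr0 mulN1r addNr.
  rewrite -{1}[u](sum_proj D) (big_morph (h^~ v) (fun x y => hD x y v) (h0 v)).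
  apply: eq_bigr => d _; rewrite -{1}[v](sum_proj D).
  exact: (big_morph _ (fun x y => hD' x y _) (h0' _)).
move=> fl fr gl gr fg u v; rewrite (exp f) // (exp g) //.
apply: eq_bigr => d _; apply: eq_bigr => e _.
by apply: (fg d e); rewrite projK eqxx.
Qed.

(** A nonzero pairing forces degrees of sum $-2$, hence of equal parity, and the two signs
    cancel. *)
Lemma B_sg r u v : B (sg r u) (sg r v) = B u v.
Proof.
move: u v; apply: bilinear_hom_ext => [a u v w|a u v w|a u v w|a u v w|d e u v du ev].
- by rewrite linearP B_linearl.
- by rewrite linearP B_linearr.
- exact: B_linearl.
- exact: B_linearr.
have [/eqP|/(B_degree du ev)] := eqVneq (d + e + 2) 0; last first.
  by rewrite (gsgn_hom _ du) (gsgn_hom _ ev) B_Zl B_Zr => ->; rewrite !mulr0.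
rewrite addr_eq0 => /eqP/(congr1 parity); rewrite parityD => /= de.
rewrite (gsgn_hom _ du) (gsgn_hom _ ev) B_Zl B_Zr mulrA -signr_addb -andb_addl.
by rewrite de mul1r.
Qed.

(** Where the pairing is nonzero both degrees have the same parity $d$, and [b_sym] carries
    $(-1)^{(d+1)^2} = -(-1)^d$. The factors $(-1)^{\deg}$ from the two copies of [B] and from
    [sg true u] reduce this to a single minus sign. *)
Lemma B_anti u v : B u v = - B v (sg true u).
Proof.
move: u v; apply: bilinear_hom_ext => [a u v w|a u v w|a u v w|a u v w|d e u v du ev].
- exact: B_linearl.
- exact: B_linearr.
- by rewrite linearP B_linearr opprD mulrN.
- by rewrite B_linearl opprD mulrN.
rewrite (gsgn_hom _ du) andbT B_Zr /symplectic_form passE.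
rewrite (gsgn_hom _ du) (gsgn_hom _ ev) !andbT !linearZl_LR /=.
have [de|de] := eqVneq (d + e + 2) 0; last first.
  have du' : u \in gr G (d + 1) by have := mem_sgr G d u; rewrite du eqxx.
  have ev' : v \in gr G (e + 1) by have := mem_sgr G e v; rewrite ev eqxx.
  have de1 : d + 1 + (e + 1) != 0 by rewrite addrACA.
  have de2 : e + 1 + (d + 1) != 0 by rewrite addrC.
  by rewrite (b_deg0 du' ev' de1) (b_deg0 ev' du' de2) !mulr0 oppr0.
have du' : u \in gr G (d + 1) by have := mem_sgr G d u; rewrite du eqxx.
have ev' : v \in gr G (e + 1) by have := mem_sgr G e v; rewrite ev eqxx.
rewrite (b_sym du' ev') signz_parity !parityD.
have /eqP := congr1 parity de; rewrite !parityD addbF => {}de.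
have -> : parity e = parity d by case: (parity d) (parity e) de => [] [].
by case: (parity d); rewrite /= ?expr0 ?expr1; ring.
Qed.

Lemma b_sg r u v : b (sg r u) (sg r v) = b u v.
Proof.
have bE x y : b x y = B (sg true x) y by rewrite /symplectic_form passE gsgnK.
by rewrite !bE !gsgn_addb addbC -gsgn_addb B_sg.
Qed.

Lemma B_inj u v : (forall w, B u w = B v w) -> u = v.
Proof.
move=> uv; apply/subr0_eq; have <- := gsgnK D true (u - v).
rewrite [X in sg true X]b_nondeg ?linear0 // => w; have := uv w.
rewrite /symplectic_form passE => E.
by rewrite linearB linearBl E subrr.
Qed.

Lemma Omega_rcons Q t y : Omega G b Q (rcons t y) = B (Q t) y.
Proof. by case: t => // x t; rewrite /= belast_rcons last_rcons. Qed.

Lemma Omega_comb k Q Q' : Omega G b (k *: Q + Q') = k *: Omega G b Q + Omega G b Q'.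
Proof.
apply/funext; case/lastP => [|t y]; last by rewrite !fctE !Omega_rcons B_linearl.
by rewrite !fctE /= scaler0 addr0.
Qed.

Lemma Omega_multilinear Q : multilinear Q -> multilinear (Omega G b Q).
Proof.
move=> Ql s t a x y; case/lastP: t => [|t z].
  by rewrite !cats1 !Omega_rcons B_linearr.
by rewrite -!rcons_cons -!rcons_cat !Omega_rcons Ql B_linearl.
Qed.

Lemma Omega_polylinear Q : polylinear Q -> polylinear (Omega G b Q).
Proof.
case=> Ql [N QN]; split; first exact: Omega_multilinear.
exists N.+1; case/lastP => [//|t y]; rewrite size_rcons ltnS => tN.
by rewrite Omega_rcons QN // B_0l.
Qed.

Lemma Omega_homog d Q : homog D D d Q -> homog D (kdec K) (d + 2) (Omega G b Q).
Proof.
move=> Qd ds s; case/lastP: s => [|t y]; first by rewrite linear0.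
rewrite -cats1 => /homlist_cat[dt [dy [-> ht hy]]]; rewrite cats1.
rewrite Omega_rcons /= /kproj; case: ifPn => // nz; symmetry.
case: dy hy nz => [|e [|f dy]] /=; rewrite /homlist /= ?andbF // andbT.
move=> /eqP ey nz.
apply: (B_degree (Qd _ _ ht) ey).
move: nz; rewrite big_cat big_seq1 /=; set S := \sum_(i <- dt) i.
by have -> : d + 2 + (S + e) = d + S + e + 2 by ring.
Qed.

Lemma Omega_parity p Q : has_parity D D p Q ->
  has_parity D (kdec K) p (Omega G b Q).
Proof.
move=> Qp r; case/lastP => [|t y]; first by rewrite gsgn_kdec /= scaler0.
by rewrite gsgn_kdec map_rcons !Omega_rcons Qp B_Zl B_sg.
Qed.

Lemma Omega_gpart q Q : multilinear Q ->
  Omega G b (gpart D D q Q) = gpart D (kdec K) q (Omega G b Q).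
Proof.
move=> Ql; apply/funext; rewrite !gpartE //; last exact: Omega_multilinear.
case/lastP => [|t y]; first by rewrite !fctE gsgn_kdec /= !scaler0 addr0 scaler0.
rewrite !fctE map_rcons !Omega_rcons gsgn_kdec B_Zl B_Dl B_Zl.
by rewrite -[B (sg true _) y](B_sg true) gsgnK.
Qed.

End Symplectic.

(** * The Pinczon bracket *)

Section Pinczon.
Variables (K : fieldType) (V : vectType K) (G : grading V) (b : {biscalar V}).
Hypothesis nz2 : (2%:R : K) != 0.
Hypothesis b_deg0 : form_of_degree0 G b.
Hypothesis b_sym : graded_symmetric G b.
Hypothesis b_nondeg : nondegenerate_form b.
Notation D := (gdec G).
Notation sg := (gsgn (gdec G)).
Notation B := (symplectic_form G b).
Notation cyclic Q := (rotate G (Omega G b Q) = Omega G b Q).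

(** The form $B(Q(\ldots),Q'(\ldots))$ that normalizes the signs of the Pinczon bracket, written
    without bases. *)
Definition pairing_tensor q (Q Q' : seq V -> V) : seq V -> K^o := fun s =>
  splits (fun a c => B (Q (map (sg q) a)) (Q' c) : K^o) s.

Lemma pairing_tensor_multilinear q Q Q' : multilinear Q -> multilinear Q' ->
  multilinear (pairing_tensor q Q Q').
Proof.
move=> Ql Q'l; apply: multilinear_splits => [c|a] s t k x y.
  by rewrite !map_cat /= linearP Ql B_linearl.
by rewrite Q'l B_linearr.
Qed.

Lemma pairing_tensor_parity p q Q Q' : has_parity D D p Q -> has_parity D D q Q' ->
  has_parity D (kdec K) (p (+) q) (pairing_tensor q Q Q').
Proof.
move=> Qp Q'q r s; rewrite gsgn_kdec /pairing_tensor splits_map.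
rewrite (raddf_splits _ _ (scaler0 _ _) (scalerDr _)).
apply: eq_splits => a c _; rewrite map_sg_addb addbC -map_sg_addb Qp Q'q.
by rewrite B_Zl B_Zr B_sg // mulrA -signr_addb andb_addl addbC.
Qed.

(** Cyclicity brings any argument [x] of [Q] into the second slot of [B]. When [x] is a value of
    [Q'], a composite paired with [y] becomes a pairing of a value of [Q] with a value of [Q']. *)
Lemma cyclic_vector p Q x a c y : multilinear Q -> has_parity D D p Q -> cyclic Q ->
  B (Q (a ++ x :: c)) y = B (Q (map (sg (~~ p)) (rcons c y) ++ a)) x.
Proof.
move=> Ql Qp Qc; rewrite -!(Omega_rcons G b Q) rcons_cat rcons_cons -cat_rcons.
have Ol := Omega_multilinear G b Ql; have Op := Omega_parity b_deg0 Qp.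
by rewrite (cyclic_cat nz2 _ _ Ol Op Qc) rcons_cat.
Qed.

Lemma pairing_swap p q Q Q' u v w :
  has_parity D D p Q -> has_parity D D q Q' ->
  B (Q (map (sg q) (map (sg (~~ (p (+) q))) v)))
    (Q' (map (sg (~~ (p (+) q))) w ++ u))
  = - (-1) ^+ (p && q) * B (Q' (map (sg (~~ q)) w ++ map (sg p) u)) (Q v).
Proof.
move=> Qp Q'q; have Q'E r z : sg r (Q' z) = (-1) ^+ (q && r) *: Q' (map (sg r) z).
  by rewrite Q'q scalerA -signr_addb addbb scale1r.
(* The two signs on [v] combine to [~~ p], with which [Q] commutes without sign; evenness of [B]
   then moves this sign to the side of [Q'], and antisymmetry exchanges the sides. *)
rewrite map_sg_addb (_ : q (+) _ = ~~ p); last by case: (p) (q) => [] [].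
rewrite Qp andbN scale1r -(B_sg b_deg0 (~~ p)) gsgnK Q'E.
rewrite [in RHS]B_anti // mulrNN Q'E !B_Zr mulrA -signr_addb.
rewrite !map_cat !map_sg_addb; congr (_ ^+ _ * B _ (Q' (map (sg _) _ ++ map (sg _) _))).
all: by case: (p) (q) => [] [].
Qed.

(* Cutting a rotated word into the arguments of [Q] and those of [Q'], the last
   letter [y] goes either to [Q], which gives [Q o Q'], or to [Q'], which gives
   [Q' o Q] after exchanging the two sides of [B]. *)
Lemma Cycl_pairing_tensor p q Q Q' t y :
  multilinear Q -> multilinear Q' ->
  has_parity D D p Q -> has_parity D D q Q' -> cyclic Q -> cyclic Q' ->
  Cycl G (pairing_tensor q Q Q') (rcons t y) = B (cbr D p q Q Q' t) y.
Proof.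
move=> Ql Q'l Qp Q'q Qc Q'c; set m := p (+) q.
have Tl := pairing_tensor_multilinear q Ql Q'l.
have Tp := pairing_tensor_parity Qp Q'q.
rewrite (Cycl_splits nz2 _ _ Tl Tp) /cbr !fctE B_Dl -scaleNr B_Zl.
have B_splits F s w : B (splits F s) w = splits (fun a c => B (F a c) w) s.
  apply: (raddf_splits (f := B^~ w)) => [|x z]; [exact: B_0l | exact: B_Dl].
rewrite /gcomp !B_splits.
under [X in _ = X + _]eq_splits => a u _.
  rewrite B_splits; under eq_splits => c d _ do
    rewrite (cyclic_vector _ _ _ _ Ql Qp Qc).
  over.
under [X in _ = _ + _ * X]eq_splits => a u _.
  rewrite B_splits; under eq_splits => c d _ do
    rewrite (cyclic_vector _ _ _ _ Q'l Q'q Q'c).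
  over.
rewrite /= -splits_assoc.
rewrite /pairing_tensor.
under eq_splits => u v _ do
  rewrite map_rcons cat_rcons splits_cat_cons splits_map.
rewrite splitsD addrC; congr (_ + _).
  apply: eq_splits => u v _; apply: eq_splits => u1 u2 _.
  rewrite map_cat /= !map_sg_addb gsgn_addb.
  have -> : q (+) ~~ (p (+) q) = ~~ p by case: (p) (q) => [] [].
  by rewrite map_rcons cat_rcons.
rewrite [RHS](raddf_splits (f := fun x => _ * x)); first last.
- by move=> x z; rewrite mulrDr.
- exact: mulr0.
apply: eq_splits => u v _.
rewrite [RHS](raddf_splits (f := fun x => _ * x)); first last.
- by move=> x z; rewrite mulrDr.
- exact: mulr0.
apply: eq_splits => v1 v2 _.
by rewrite -cat_rcons -map_rcons pairing_swap.
Qed.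

Variables (n : nat) (e e' : n.-tuple V).
Hypothesis dual_ee' : dual_bases b e e'.

(** The inverse of [Omega] up to constant terms, obtained by solving $B(Q(t),x)=O(t,x)$ in the dual
    basis. The minus sign comes from $B(e'_i,x)=-b(x,e'_i)$. *)
Definition map_of_form (O : seq V -> K^o) : seq V -> V := fun t =>
  - \sum_i (O (rcons t (tnth e i)) : K) *: tnth e' i.

Lemma dual_expand v : v = \sum_i b v (tnth e' i) *: tnth e i.
Proof.
have [be _ bee'] := dual_ee'.
have vE : v = \sum_i coord e i v *: tnth e i.
  rewrite {1}(coord_basis be (memvf v)); apply: eq_bigr => i _.
  by rewrite (tnth_nth 0).
rewrite {1}vE; apply: eq_bigr => i _; congr (_ *: _).
rewrite [in RHS]vE linear_sumlz (bigD1 i) //= linearZl_LR bee' eqxx.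
rewrite big1 ?addr0 => [|j ji]; first by rewrite [RHS]mulr1.
by rewrite linearZl_LR bee' (negPf ji) /= [LHS]mulr0.
Qed.

Lemma map_of_formP O t x : multilinear O -> B (map_of_form O t) x = O (rcons t x).
Proof.
move=> Ol; have Be i : B (tnth e' i) x = - b x (tnth e' i).
  by rewrite B_anti // /symplectic_form passE b_sg.
rewrite /map_of_form -scaleN1r B_Zl mulN1r B_suml -sumrN.
rewrite [in RHS](dual_expand x) -cats1 multilinear_sum //; apply: eq_bigr => i _.
by rewrite B_Zl Be mulrN opprK multilinearZ // cats1 [RHS]mulrC.
Qed.

Lemma map_of_form_comb k O O' :
  map_of_form (k *: O + O') = k *: map_of_form O + map_of_form O'.
Proof.
apply/funext => t; rewrite !fctE /map_of_form scalerN -opprD scaler_sumr -big_split.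
by congr (- _); apply: eq_bigr => i _; rewrite scalerDl scalerA.
Qed.

Lemma map_of_form_multilinear O : multilinear O -> multilinear (map_of_form O).
Proof.
move=> Ol s t k x y; apply: (B_inj b_nondeg (G := G)) => w.
by rewrite B_linearl !map_of_formP // !rcons_cat !rcons_cons Ol.
Qed.

Lemma map_of_form_polylinear O : polylinear O -> polylinear (map_of_form O).
Proof.
case=> Ol [N ON]; split; first exact: map_of_form_multilinear.
exists N => s sN; apply: (B_inj b_nondeg (G := G)) => w.
by rewrite map_of_formP // ON ?B_0l // size_rcons ltnS ltnW.
Qed.

(** The component of degree [f] of a value pairs only with letters of degree $-2-f$. For [f != k]
    such a pairing is a value of [O] on letters of wrong total degree, hence 0, and nondegeneracy
    kills the component. *)
Lemma map_of_form_homog d O : multilinear O -> homog D (kdec K) (d + 2) O ->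
  homog D D d (map_of_form O).
Proof.
move=> Ol Od ds t ht; set k := d + _; set u := map_of_form O t.
suff orth f : f != k -> proj D f u = 0.
  have [Dk|D'k] := boolP (k \in degs D).
    by rewrite -[RHS](sum_proj D) (bigD1_seq k) ?degs_uniq //= big1 ?addr0.
  rewrite proj_out // -[RHS](sum_proj D) big_seq big1 // => f Df; apply: orth.
  by apply: contraNneq D'k => <-.
move=> fk; apply: (B_inj b_nondeg (G := G)) => w; rewrite B_0l.
rewrite -[w](sum_proj D) B_sumr big1 // => g _.
have [fg|fg] := eqVneq (f + g + 2) 0; last first.
  by apply: B_degree fg => //; rewrite projK eqxx.
transitivity (B u (proj D g w)).
  rewrite -[u in RHS](sum_proj D) B_suml.
  have [Df|D'f] := boolP (f \in degs D).
    rewrite [RHS](bigD1_seq f) ?degs_uniq //= big1 ?addr0 // => h hf.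
    apply: (@B_degree _ _ _ _ b_deg0 h g); rewrite ?projK ?eqxx //.
    apply: contraNneq hf => hg; apply/eqP.
    by move: fg hg; lia.
  rewrite proj_out // B_0l [RHS]big_seq big1 // => h Dh.
  apply: (@B_degree _ _ _ _ b_deg0 h g); rewrite ?projK ?eqxx //.
  apply: contraNneq D'f => hg; suff -> : f = h by [].
  by move: fg hg; lia.
rewrite map_of_formP // -(Od (rcons ds g)) /= /kproj.
  case: eqP => // kg; case/eqP: fk; move: fg kg.
  rewrite -cats1 big_cat big_seq1 /= /k; set S := \sum_(i <- ds) i.
  by lia.
rewrite -!cats1; apply: cat_homlist => //.
by rewrite /homlist /= gprojK !eqxx.
Qed.

Lemma Omega_map_of_form O s : multilinear O -> s != [::] ->
  Omega G b (map_of_form O) s = O s.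
Proof. by case/lastP: s => // t y Ol _; rewrite Omega_rcons map_of_formP. Qed.

(** [map_of_form] forgets exactly the constant term, so an identity of forms splits into one scalar
    identity and one identity of maps. *)
Lemma form_ext O O' : multilinear O -> multilinear O' -> O [::] = O' [::] ->
  map_of_form O = map_of_form O' -> O = O'.
Proof.
move=> Ol O'l O0 eqO; apply/funext; case/lastP => // t y.
by rewrite -!map_of_formP // eqO.
Qed.

Lemma map_of_form_cyclic O : multilinear O -> rotate G O = O ->
  cyclic (map_of_form O).
Proof.
move=> Ol Oc; apply/funext; case/lastP => // t y.
rewrite Omega_map_of_form // -?size_eq0 ?size_rcons // -[in RHS]Oc !rotate_rcons.
by apply: eq_bigr => p _; rewrite Omega_map_of_form.
Qed.

Lemma map_of_Omega Q : multilinear Q -> map_of_form (Omega G b Q) = Q.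
Proof.
move=> Ql; apply/funext => t; apply: (B_inj b_nondeg (G := G)) => w.
by rewrite map_of_formP ?Omega_rcons //; apply: Omega_multilinear.
Qed.

Lemma map_of_form_gpart q O c x : multilinear O ->
  gpart D (kdec K) q O (rcons c x) = B (gpart D D q (map_of_form O) c) x.
Proof.
move=> Ol; have Ql := map_of_form_multilinear Ol.
rewrite !gpartE // !fctE gsgn_kdec map_rcons -!map_of_formP // B_Zl B_Dl B_Zl.
by rewrite -[B (sg true _) x](B_sg b_deg0 true) gsgnK.
Qed.

(** Expanding the second argument of [B] as $v=\sum_i b(v,e'_i)e_i$ absorbs the sum over the dual
    bases; in particular the tensor does not depend on them. *)
Lemma dual_tensorE O O' : multilinear O -> multilinear O' ->
  dual_tensor G e e' O O' = \sum_p \sum_q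
    pairing_tensor q (gpart D D p (map_of_form O)) (gpart D D q (map_of_form O')).
Proof.
move=> Ol O'l; have Ql := map_of_form_multilinear Ol.
apply/funext => s; rewrite exchange_big fct_sumE /dual_tensor passE exchange_big.
apply: eq_bigr => q _; rewrite fct_sumE exchange_big.
rewrite -[RHS]splits_sum; apply: eq_bigr => j _.
set a := map _ _; set v := gpart D D q _ _.
transitivity (B (map_of_form O a) v); last first.
  by rewrite {1}(sum_gpart D D Ql) fct_sumE B_suml.
rewrite [X in B _ X]dual_expand B_sumr; apply: eq_bigr => i _.
rewrite /insert fpartE map_of_form_gpart // B_Zr map_of_formP // mulrC.
by congr (_ * _); rewrite /symplectic_form passE b_sg.
Qed.

Lemma dual_tensor_multilinear O O' : multilinear O -> multilinear O' ->
  multilinear (dual_tensor G e e' O O').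
Proof.
move=> Ol O'l; rewrite dual_tensorE //.
have lD F F' : multilinear F -> multilinear F' -> multilinear (F + F').
  by move=> ? ?; rewrite -[F]scale1r; apply: multilinear_comb.
have Tl p q : multilinear (pairing_tensor q
    (gpart D D p (map_of_form O)) (gpart D D q (map_of_form O'))).
  by apply: pairing_tensor_multilinear; apply: gpart_multilinear => //;
    apply: map_of_form_multilinear.
by rewrite !big_bool; apply: (lD); apply: (lD).
Qed.

Lemma Omega_gpart_cyclic q Q : multilinear Q -> cyclic Q -> cyclic (gpart D D q Q).
Proof.
move=> Ql Qc; have Ol := Omega_multilinear G b Ql.
by rewrite Omega_gpart // rotate_gpart // Qc.
Qed.

Lemma pinczon_rcons O O' t y : multilinear O -> multilinear O' ->
  rotate G O = O -> rotate G O' = O' ->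
  pinczon_bracket G e e' O O' (rcons t y)
  = B (gbr D (map_of_form O) (map_of_form O') t) y.
Proof.
move=> Ol O'l Oc O'c; rewrite /pinczon_bracket dual_tensorE //.
have C0 : Cycl G 0 = 0.
  have := Cycl_comb G (-1) 0 0; rewrite scaler0 addr0 => ->.
  by rewrite scaleN1r addNr.
have CD F F' : Cycl G (F + F') = Cycl G F + Cycl G F'.
  by have := Cycl_comb G 1 F F'; rewrite !scale1r.
rewrite (big_morph _ CD C0) fct_sumE /gbr fct_sumE B_suml.
apply: eq_bigr => p _.
rewrite (big_morph _ CD C0) !fct_sumE B_suml.
have Ql := map_of_form_multilinear Ol; have Q'l := map_of_form_multilinear O'l.
have Qc := map_of_form_cyclic Ol Oc; have Q'c := map_of_form_cyclic O'l O'c.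
apply: eq_bigr => q _; apply: Cycl_pairing_tensor;
  by [apply: gpart_multilinear | apply: gpart_parity | apply: Omega_gpart_cyclic].
Qed.

(** [Cycl] has a single term on the empty word. This scalar is the part of the bracket that [gbr]
    does not see; it can be nonzero only if both forms have a component in $\mathcal C^1$. *)
Lemma pinczon_nil O O' : multilinear O -> multilinear O' ->
  pinczon_bracket G e e' O O' [::] = B (map_of_form O [::]) (map_of_form O' [::]).
Proof.
move=> Ol O'l; rewrite /pinczon_bracket /Cycl big_ord1 /= dual_tensorE //.
rewrite [in RHS](sum_gpart D D (map_of_form_multilinear Ol)).
rewrite [in RHS](sum_gpart D D (map_of_form_multilinear O'l)).
rewrite !fct_sumE B_suml; apply: eq_bigr => p _.
rewrite !fct_sumE B_sumr; apply: eq_bigr => q _.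
by rewrite /pairing_tensor splits_nil.
Qed.

(** Linearity concerns nonempty words, on which the bracket agrees with [Omega] of a bracket of
    maps. *)
Lemma pinczon_multilinear O O' : polylinear O -> polylinear O' ->
  rotate G O = O -> rotate G O' = O' ->
  multilinear (pinczon_bracket G e e' O O').
Proof.
move=> Op O'p Oc O'c s t k x y; have [Ol _] := Op; have [O'l _] := O'p.
have PE u z v : pinczon_bracket G e e' O O' (u ++ z :: v)
    = Omega G b (gbr D (map_of_form O) (map_of_form O')) (u ++ z :: v).
  case/lastP: v => [|v w]; first by rewrite cats1 Omega_rcons pinczon_rcons.
  by rewrite -rcons_cons -rcons_cat Omega_rcons pinczon_rcons.
rewrite !PE; apply: Omega_multilinear.
by case: (@gbr_polylinear _ _ D nz2 (map_of_form O) (map_of_form O'));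
  try apply: map_of_form_polylinear.
Qed.

Lemma map_of_pinczon O O' : polylinear O -> polylinear O' ->
  rotate G O = O -> rotate G O' = O' ->
  map_of_form (pinczon_bracket G e e' O O')
  = gbr D (map_of_form O) (map_of_form O').
Proof.
move=> Op O'p Oc O'c; apply/funext => t; apply: (B_inj b_nondeg (G := G)) => w.
rewrite map_of_formP; last exact: pinczon_multilinear.
by apply: pinczon_rcons => //; [case: Op | case: O'p].
Qed.

Lemma pinczon_cyclic O O' : cyclic_forms G O -> cyclic_forms G O' ->
  cyclic_forms G (pinczon_bracket G e e' O O').
Proof.
case=> Op Oc [O'p O'c]; have [Ol _] := Op; have [O'l _] := O'p.
split; last by rewrite rotate_Cycl //; apply: dual_tensor_multilinear.
split; first exact: pinczon_multilinear.
have [_ [N gN]] := gbr_polylinear D nz2 (map_of_form_polylinear Op)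
  (map_of_form_polylinear O'p).
exists N.+1; case/lastP => // t y; rewrite size_rcons ltnS => tN.
by rewrite pinczon_rcons // gN // B_0l.
Qed.

End Pinczon.

(** * Conditions on low arities, graded subspaces and the two Lie algebras *)

Section Truncation.
Variables (K : fieldType) (V : vectType K) (W : lmodType K).
Variables (D : decomposition V) (DW : decomposition W).
Implicit Types F : seq V -> W.

(** Vanishing in arities below [n] becomes the kernel of a linear map of degree 0, to which
    [graded_subspace_ker] applies. *)
Definition truncation n F : seq V -> W := fun s => if (size s < n)%N then F s else 0.

Lemma truncation_comb n k F F' :
  truncation n (k *: F + F') = k *: truncation n F + truncation n F'.
Proof.
apply/funext => s; rewrite !fctE /truncation.
by case: ifP => // _; rewrite scaler0 addr0.
Qed.

Lemma truncation_polylinear n F : polylinear F -> polylinear (truncation n F).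
Proof.
case=> Fl [N FN]; split=> [s t k x y|]; last first.
  by exists N => s sN; rewrite /truncation FN ?if_same.
rewrite /truncation !size_cat /=; case: ifP => _; first exact: Fl.
by rewrite scaler0 addr0.
Qed.

Lemma truncation_homog n d F : homog D DW d F -> homog D DW d (truncation n F).
Proof.
move=> Fd ds s hs; rewrite /truncation; case: ifP => _; first exact: Fd.
exact: linear0.
Qed.

Lemma truncation_eq0 n F :
  truncation n F = 0 <-> forall s, (size s < n)%N -> F s = 0.
Proof.
split=> [F0 s sn|F0]; first by have := congr1 (@^~ s) F0; rewrite /truncation sn.
by apply/funext => s; rewrite /truncation; case: ifP => // /F0.
Qed.

End Truncation.

Lemma graded_subspace_shift (K : fieldType) (L : lmodType K) (A : set L)
    (deg : int -> set L) (k : int) :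
  graded_subspace A deg -> graded_subspace A (fun d => deg (d + k)).
Proof.
case=> sA sAd Aspan Adir; split=> // [x Ax|ds c Uds cP c0 d ds_d].
  have [ds [c [cP ->]]] := Aspan x Ax.
  exists [seq d - k | d <- ds], (fun d => c (d + k)); split=> //.
  by rewrite big_map; apply: eq_bigr => d _; rewrite subrK.
have := Adir [seq d + k | d <- ds] (fun d => c (d - k)) _ _ _ (d + k).
rewrite addrK; apply.
- by rewrite map_inj_uniq //; apply: addIr.
- by move=> e; have := cP (e - k); rewrite subrK.
- by rewrite big_map -[RHS]c0; apply: eq_bigr => e _; rewrite addrK.
- by apply/mapP; exists d.
Qed.

Section Main.
Variables (K : fieldType) (V : vectType K) (G : grading V) (b : {biscalar V}).
Hypothesis nz2 : (2%:R : K) != 0.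
Hypothesis b_deg0 : form_of_degree0 G b.
Hypothesis b_sym : graded_symmetric G b.
Hypothesis b_nondeg : nondegenerate_form b.
Variables (n : nat) (e e' : n.-tuple V).
Hypothesis dual_ee' : dual_bases b e e'.
Notation D := (gdec G).
Notation sg := (gsgn (gdec G)).
Notation B := (symplectic_form G b).
Notation pinczon := (pinczon_bracket G e e').
Notation mapof := (map_of_form e e').
Notation cyclic Q := (rotate G (Omega G b Q) = Omega G b Q).

Lemma multimap_degree_homog : multimap_degree G = homog D D.
Proof. by apply/funext => d; rewrite multimap_degreeE. Qed.

Lemma form_shifted_degree_homog :
  form_shifted_degree G = fun d => homog D (kdec K) (d + 2).
Proof. by apply/funext => d; rewrite /form_shifted_degree form_degreeE. Qed.

Lemma multimaps_graded : graded_subspace (@multimaps K V) (multimap_degree G).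
Proof.
have -> : @multimaps K V = fun Q => polylinear Q /\ truncation 1 Q = 0.
  apply/funext => Q; apply/propext; rewrite truncation_eq0.
  split=> [[Qp Q0]|[Qp Q0]]; split=> //; last exact: Q0.
  by case.
rewrite multimap_degree_homog.
apply: (graded_subspace_ker (k := 0) (polylinear_graded D D) (polylinear_graded D D)).
  by move=> a F F' _ _; apply: truncation_comb.
move=> d F Fp Fd; rewrite addr0; split; first exact: truncation_polylinear.
exact: truncation_homog.
Qed.

Lemma quadratic_graded :
  graded_subspace (quadratic_maps G b) (multimap_degree G).
Proof.
have -> : quadratic_maps G b
    = fun Q => multimaps Q /\ (rotate G (Omega G b Q) - Omega G b Q) = 0.
  apply/funext => Q; apply/propext; split=> -[Qm Qc]; split=> //.
    by rewrite Qc subrr.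
  exact: subr0_eq.
(* The shift 2 is the degree of [B], hence of [Omega]. *)
apply: (graded_subspace_ker (k := 2) multimaps_graded (polylinear_graded D (kdec K))).
  move=> a F F' _ _; rewrite Omega_comb rotate_comb scalerBr.
  by rewrite opprD addrACA.
rewrite multimap_degree_homog => d F [Fp _] Fd; have [Fl _] := Fp.
have Op := Omega_polylinear G b Fp; have [Ol _] := Op.
have Od := Omega_homog b_deg0 Fd.
have sp := subspace_setI (polylinear_subspace V K^o)
  (homog_subspace D (kdec K) (d + 2)).
rewrite [rotate G _ - _]addrC -scaleN1r; case: sp => _; apply; split=> //.
  exact: rotate_polylinear.
exact: rotate_homog.
Qed.

Lemma cyclic_forms_graded :
  graded_subspace (cyclic_forms G) (form_shifted_degree G).
Proof.
rewrite form_shifted_degree_homog.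
have gp := graded_subspace_shift 2 (polylinear_graded D (kdec K)).
have -> : cyclic_forms G = fun O => polylinear O /\ (rotate G O - O) = 0.
  apply/funext => O; apply/propext; split=> -[Op Oc]; split=> //.
    by rewrite Oc subrr.
  exact: subr0_eq.
apply: (graded_subspace_ker (k := 0) gp gp).
  by move=> a F F' _ _; rewrite rotate_comb scalerBr opprD addrACA.
move=> d O Op Od; have [Ol _] := Op; rewrite addr0.
have sp := subspace_setI (polylinear_subspace V K^o)
  (homog_subspace D (kdec K) (d + 2)).
rewrite [rotate G _ - _]addrC -scaleN1r; case: sp => _; apply; split=> //.
  exact: rotate_polylinear.
exact: rotate_homog.
Qed.

Lemma cyclic_forms_ge2_graded :
  graded_subspace (cyclic_forms_ge2 G) (form_shifted_degree G).
Proof.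
have -> : cyclic_forms_ge2 G = fun O => cyclic_forms G O /\ truncation 2 O = 0.
  by apply/funext => O; apply/propext; rewrite truncation_eq0.
have gp := graded_subspace_shift 2 (polylinear_graded D (kdec K)).
apply: (graded_subspace_ker (k := 0) cyclic_forms_graded gp).
  by move=> a F F' _ _; apply: truncation_comb.
rewrite form_shifted_degree_homog => d F [Fp _] Fd; rewrite addr0.
by split; [apply: truncation_polylinear | apply: truncation_homog].
Qed.

(** [Omega] has no constant term, so the constant term of the right side must vanish; it does
    because [Q] is 0 on the empty word. *)
Lemma Omega_gbr Q Q' : multimaps Q -> multimaps Q' -> cyclic Q -> cyclic Q' ->
  Omega G b (gbr D Q Q') = pinczon (Omega G b Q) (Omega G b Q').
Proof.
case=> -[Ql _] Q0 [[Q'l _] _] Qc Q'c.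
have Ol := Omega_multilinear G b Ql; have O'l := Omega_multilinear G b Q'l.
apply/funext; case/lastP => [|t y].
  rewrite (pinczon_nil nz2 b_deg0 b_sym b_nondeg dual_ee') //.
  by rewrite !(map_of_Omega b_deg0 b_sym b_nondeg dual_ee') // Q0 B_0l.
by rewrite Omega_rcons (pinczon_rcons nz2 b_deg0 b_sym b_nondeg dual_ee') //
  !(map_of_Omega b_deg0 b_sym b_nondeg dual_ee').
Qed.

Lemma gpart_nil q (Q : seq V -> V) :
  multilinear Q -> Q [::] = 0 -> gpart D D q Q [::] = 0.
Proof.
by move=> Ql Q0; rewrite gpartE // !fctE /= Q0 linear0 scaler0 addr0 scaler0.
Qed.

Lemma cbr_nil p q Q Q' : cbr D p q Q Q' [::]
  = Q [:: Q' [::]] - (-1) ^+ (p && q) *: Q' [:: Q [::]].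
Proof. by rewrite /cbr !fctE /gcomp !splits_nil. Qed.

Lemma multimaps_gbr Q Q' : multimaps Q -> multimaps Q' -> multimaps (gbr D Q Q').
Proof.
case=> Qp Q0 [Q'p Q'0]; split; first exact: gbr_polylinear.
have [Ql _] := Qp; have [Q'l _] := Q'p.
have z F : multilinear F -> F [:: 0] = 0 by apply: (multilinear0 [::] [::]).
rewrite /gbr fct_sumE big1 // => p _; rewrite fct_sumE big1 // => q _.
rewrite cbr_nil !gpart_nil // !z ?scaler0 ?subrr //; exact: gpart_multilinear.
Qed.

Lemma multimaps_Lie :
  graded_Lie_algebra (@multimaps K V) (multimap_degree G) (mbracket G).
Proof.
apply: (@graded_Lie_subalgebra_algebra _ _ (@polylinear K V V)).
split; first exact: polylinear_Lie.
- by move=> Q [].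
- exact: multimaps_graded.
- by rewrite mbracketE; apply: multimaps_gbr.
Qed.

Lemma quadratic_subalgebra : graded_Lie_subalgebra (@multimaps K V)
  (multimap_degree G) (mbracket G) (quadratic_maps G b).
Proof.
split; first exact: multimaps_Lie.
- by move=> Q [].
- exact: quadratic_graded.
- move=> Q Q' [Qm Qc] [Q'm Q'c]; rewrite mbracketE.
  split; first exact: multimaps_gbr.
  rewrite Omega_gbr //; have [Qp _] := Qm; have [Q'p _] := Q'm.
  have [] // := @pinczon_cyclic _ _ G b nz2 b_deg0 b_sym b_nondeg n e e' dual_ee'
    (Omega G b Q) (Omega G b Q').
    by split=> //; apply: Omega_polylinear.
  by split=> //; apply: Omega_polylinear.
Qed.

Lemma B_odd (p q : bool) u v : sg true u = (-1) ^+ p *: u -> sg true v = (-1) ^+ q *: v ->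
  p != q -> B u v = 0.
Proof.
move=> up vq pq; have := B_sg b_deg0 true u v.
rewrite up vq B_Zl B_Zr mulrA -signr_addb.
have -> : p (+) q by rewrite -negb_eqb.
rewrite mulN1r => /eqP; rewrite eq_sym -subr_eq0 opprK -mulr2n -mulr_natl.
by rewrite mulf_eq0 (negPf nz2) => /eqP.
Qed.

Lemma B_skew (p q : bool) u v :
  sg true u = (-1) ^+ p *: u -> sg true v = (-1) ^+ q *: v ->
  B u v = - (-1) ^+ (p && q) * B v u.
Proof.
move=> up vq; have [pq|pq] := eqVneq p q; last first.
  by rewrite (B_odd up vq pq) (B_odd vq up) ?mulr0 // eq_sym.
by rewrite B_anti // up B_Zr pq andbb mulNr.
Qed.

(** The constant term of the Jacobi identity, in the constants $x,y,z$ and the unary components of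
    the maps. Cyclicity of the unary components and antisymmetry of [B] reduce its six pairings to
    $B(X(y),z)$, $B(Y(x),z)$ and $B(Z(x),y)$, whose coefficients agree for every choice of
    parities. *)
Lemma jacobi_nil_parity p q r X Y Z :
  multilinear X -> multilinear Y -> multilinear Z ->
  has_parity D D p X -> has_parity D D q Y -> has_parity D D r Z ->
  cyclic X -> cyclic Y -> cyclic Z ->
  B (X [::]) (cbr D q r Y Z [::]) = B (cbr D p q X Y [::]) (Z [::])
    + (-1) ^+ (p && q) * B (Y [::]) (cbr D p r X Z [::]).
Proof.
move=> Xl Yl Zl Xp Yq Zr Xc Yc Zc; rewrite !cbr_nil.
have nilE s F : has_parity D D s F -> sg true (F [::]) = (-1) ^+ s *: F [::].
  move=> /(_ true [::])/= {2}->; rewrite andbT scalerA -signr_addb addbb.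
  by rewrite scale1r.
have xp := nilE _ _ Xp; have yq := nilE _ _ Yq; have zr := nilE _ _ Zr.
move: (X [::]) (Y [::]) (Z [::]) xp yq zr => x y z xp yq zr.
have parE (s t : bool) F u : multilinear F -> has_parity D D s F ->
    sg true u = (-1) ^+ t *: u -> sg true (F [:: u]) = (-1) ^+ (s (+) t) *: F [:: u].
  move=> Fl Fs ut; have := Fs true [:: u]; rewrite /= ut (multilinearZ [::]) // andbT.
  move=> /(congr1 (GRing.scale ((-1) ^+ s))).
  by rewrite !scalerA -!signr_addb addbb scale1r.
have cyc (s t : bool) F u v : multilinear F -> has_parity D D s F -> cyclic F ->
    sg true v = (-1) ^+ t *: v ->
    B (F [:: u]) v = (-1) ^+ (~~ s && t) * B (F [:: v]) u.
  move=> Fl Fs Fc vt.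
  have := cyclic_vector nz2 b_deg0 u [::] [::] v Fl Fs Fc => /= ->.
  suff -> : sg (~~ s) v = (-1) ^+ (~~ s && t) *: v.
    by rewrite (multilinearZ [::]) // B_Zl.
  by case: (~~ s); rewrite ?gsgn_false ?scale1r.
have Yz := parE _ _ _ _ Yl Yq zr; have Xz := parE _ _ _ _ Xl Xp zr.
have Zy := parE _ _ _ _ Zl Zr yq; have Zx := parE _ _ _ _ Zl Zr xp.
rewrite -!scaleNr addrC !B_linearr addrC [X [:: y] + _]addrC B_linearl.
rewrite [X [:: z] + _]addrC B_linearr.
rewrite (B_anti b_deg0 b_sym x (Y _)) xp B_Zr (cyc q p Y z x) //.
rewrite (B_anti b_deg0 b_sym x (Z _)) xp B_Zr (cyc r p Z y x) //.
rewrite (B_anti b_deg0 b_sym y (X _)) yq B_Zr (cyc p q X z y) //.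
rewrite (B_skew yq Zx).
by case: p q r {Xp Yq Zr xp yq zr Yz Xz Zy Zx} => [] [] [] /=; ring.
Qed.

Lemma jacobi_nil p q X Y Z :
  multilinear X -> multilinear Y -> multilinear Z ->
  has_parity D D p X -> has_parity D D q Y ->
  cyclic X -> cyclic Y -> cyclic Z ->
  B (X [::]) (gbr D Y Z [::]) = B (gbr D X Y [::]) (Z [::])
    + (-1) ^+ (p && q) * B (Y [::]) (gbr D X Z [::]).
Proof.
move=> Xl Yl Zl Xp Yq Xc Yc Zc.
have pl r : multilinear (gpart D D r Z) by apply: gpart_multilinear.
have pp r : has_parity D D r (gpart D D r Z) by apply: gpart_parity.
have E r : B (X [::]) (gbr D Y (gpart D D r Z) [::])
  = B (gbr D X Y [::]) (gpart D D r Z [::])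
    + (-1) ^+ (p && q) * B (Y [::]) (gbr D X (gpart D D r Z) [::]).
  rewrite (gbr_parity nz2 Yl (pl r) Yq (pp r)) (gbr_parity nz2 Xl (pl r) Xp (pp r)).
  rewrite (gbr_parity nz2 Xl Yl Xp Yq).
  by apply: jacobi_nil_parity => //; apply: Omega_gpart_cyclic.
have ZE : Z = 1 *: gpart D D true Z + gpart D D false Z.
  by rewrite scale1r {1}(sum_gpart D D Zl) big_bool.
rewrite ZE !gbr_combr // !fctE !scale1r !B_Dr !E mulrDr.
by rewrite addrACA.
Qed.

Lemma gbr_homog d1 d2 Q Q' : multilinear Q -> multilinear Q' ->
  homog D D d1 Q -> homog D D d2 Q' -> homog D D (d1 + d2) (gbr D Q Q').
Proof.
move=> Ql Q'l Qd Q'd.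
rewrite (gbr_parity nz2 Ql Q'l (homog_parity Ql Qd) (homog_parity Q'l Q'd)).
exact: cbr_homog.
Qed.

Lemma cyclic_forms_Lie :
  graded_Lie_algebra (cyclic_forms G) (form_shifted_degree G) pinczon.
Proof.
have gr := cyclic_forms_graded.
have cl O O' : cyclic_forms G O -> cyclic_forms G O' -> cyclic_forms G (pinczon O O').
  by move=> h h'; apply: (pinczon_cyclic nz2 b_deg0 b_sym b_nondeg dual_ee').
have comb a O O' : cyclic_forms G O -> cyclic_forms G O' ->
    cyclic_forms G (a *: O + O') by case: gr => -[_ + _ _ _]; apply.
have ml O : cyclic_forms G O -> multilinear O by move=> [[]].
have mp O : cyclic_forms G O -> polylinear (mapof O).
  by move=> [Op _]; apply: (map_of_form_polylinear b_deg0 b_sym b_nondeg dual_ee').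
have mm O : cyclic_forms G O -> multilinear (mapof O) by move=> /mp[].
have mc O : cyclic_forms G O -> cyclic (mapof O).
  by move=> [[Ol _] Oc]; apply: map_of_form_cyclic.
have nilE O O' : cyclic_forms G O -> cyclic_forms G O' ->
    pinczon O O' [::] = B (mapof O [::]) (mapof O' [::]).
  by move=> /ml ? /ml ?; apply: (pinczon_nil nz2 b_deg0 b_sym b_nondeg dual_ee').
have mapE O O' : cyclic_forms G O -> cyclic_forms G O' ->
    mapof (pinczon O O') = gbr D (mapof O) (mapof O').
  by move=> [Op Oc] [O'p O'c]; apply: (map_of_pinczon nz2 b_deg0 b_sym b_nondeg dual_ee').
have ext O O' : cyclic_forms G O -> cyclic_forms G O' ->
    O [::] = O' [::] -> mapof O = mapof O' -> O = O'.
  by move=> /ml ? /ml ?; apply: (form_ext b_deg0 b_sym dual_ee').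
have md d O : cyclic_forms G O -> homog D (kdec K) (d + 2) O ->
    homog D D d (mapof O).
  by move=> /ml ?; apply: (map_of_form_homog nz2 b_deg0 b_sym b_nondeg dual_ee').
have nil_proj d O : cyclic_forms G O -> homog D (kdec K) (d + 2) O ->
    proj D d (mapof O [::]) = mapof O [::].
  by move=> Oc /(md _ _ Oc)/(_ [::] [::] isT); rewrite big_nil addr0.
rewrite form_shifted_degree_homog in gr *; split=> //.
- move=> a x y z cx cy cz; apply: ext; first by apply: (cl) => //; apply: comb.
  + by apply: comb; apply: (cl).
  + rewrite nilE //; last exact: comb.
    by rewrite !fctE !nilE // map_of_form_comb !fctE B_linearl.
  + rewrite mapE //; last exact: comb.
    by rewrite !map_of_form_comb !mapE // gbr_combl //; apply: mm.
- move=> a x y z cx cy cz; apply: ext; first by apply: (cl) => //; apply: comb.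
  + by apply: comb; apply: (cl).
  + rewrite nilE //; last exact: comb.
    by rewrite !fctE !nilE // map_of_form_comb !fctE B_linearr.
  + rewrite mapE //; last exact: comb.
    by rewrite !map_of_form_comb !mapE // gbr_combr //; apply: mm.
- move=> d1 d2 x y cx cy xd yd ds s; case/lastP: s => [|t w].
    (* The constant term pairs values of degrees [d1] and [d2], so it vanishes unless
       [d1 + d2 + 2 = 0]. *)
    case: ds => // _; rewrite big_nil addr0 /= /kproj.
    case: eqP => // /eqP nz; symmetry; rewrite nilE //.
    exact: (B_degree b_deg0 (nil_proj _ _ cx xd) (nil_proj _ _ cy yd)).
  move=> hs.
  have -> : pinczon x y (rcons t w) = Omega G b (gbr D (mapof x) (mapof y)) (rcons t w).
    rewrite Omega_rcons; apply: pinczon_rcons => //; try exact: ml.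
      by case: cx.
    by case: cy.
  apply: (Omega_homog b_deg0 _ hs).
  exact: gbr_homog (mm _ cx) (mm _ cy) (md _ _ cx xd) (md _ _ cy yd).
- move=> d1 d2 x y cx cy xd yd.
  have xp := homog_parity (mm _ cx) (md _ _ cx xd).
  have yp := homog_parity (mm _ cy) (md _ _ cy yd).
  (* Recast as a linear combination with 0, the shape that [comb] and [map_of_form_comb] accept. *)
  have -> : - ((-1) ^ (d1 * d2) *: pinczon y x)
          = (- (-1) ^ (d1 * d2)) *: pinczon y x + 0 by rewrite scaleNr addr0.
  have c0 : cyclic_forms G 0 by case: cyclic_forms_graded => -[].
  apply: ext; [exact: cl | by apply: comb => //; apply: (cl) | |].
    rewrite !fctE !nilE // signz_parity [RHS]addr0.
    apply: B_skew; rewrite -[parity _]andbT.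
      exact/gsgn_hom/nil_proj.
    exact/gsgn_hom/nil_proj.
  have m0 : mapof (0 : seq V -> K^o) = 0.
    have := map_of_form_comb e e' (-1) 0 0; rewrite scaler0 addr0 => ->.
    by rewrite scaleN1r addNr.
  rewrite map_of_form_comb m0 addr0 !mapE // scaleNr signz_parity.
  rewrite (gbr_parity nz2 (mm _ cx) (mm _ cy) xp yp).
  rewrite (gbr_parity nz2 (mm _ cy) (mm _ cx) yp xp) /cbr.
  by rewrite andbC scalerBr scalerA -signr_addb addbb scale1r opprB.
- move=> d1 d2 x y z cx cy cz xd yd.
  have xp := homog_parity (mm _ cx) (md _ _ cx xd).
  have yp := homog_parity (mm _ cy) (md _ _ cy yd).
  rewrite addrC; apply: ext.
  + by apply: (cl) => //; apply: (cl).
  + by apply: comb; apply: (cl) => //; apply: (cl).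
  + rewrite !fctE nilE //; last exact: cl.
    rewrite [pinczon y _ _]nilE //; last exact: cl.
    rewrite [pinczon (pinczon x y) _ _]nilE //; last exact: cl.
    rewrite !mapE // signz_parity addrC.
    by apply: jacobi_nil => //; try exact: mm; exact: mc.
  + rewrite map_of_form_comb !mapE //; try exact: cl.
    rewrite signz_parity addrC.
    by apply: gbr_jacobi => //; try exact: mm; exact: mp.
Qed.

(** Forms without components of arity 0 and 1 have associated maps in [multimaps]. The constant term
    of a bracket is then a pairing with 0, and its linear term is given by the bracket of the two
    maps on the empty word, again 0. *)
Lemma cyclic_forms_ge2_subalgebra : graded_Lie_subalgebra (cyclic_forms G)
  (form_shifted_degree G) pinczon (cyclic_forms_ge2 G).
Proof.
have mapof0 O : cyclic_forms_ge2 G O -> mapof O [::] = 0.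
  case=> -[[Ol _] _] O0; apply: (B_inj b_nondeg (G := G)) => w.
  by rewrite (map_of_formP b_deg0 b_sym dual_ee') // O0 // B_0l.
have mm O : cyclic_forms_ge2 G O -> multimaps (mapof O).
  move=> O2; split; last exact: mapof0.
  case: O2 => -[Op _] _.
  exact: (map_of_form_polylinear b_deg0 b_sym b_nondeg dual_ee').
split; first exact: cyclic_forms_Lie.
- by move=> O [].
- exact: cyclic_forms_ge2_graded.
- move=> O O' O2 O'2; have [Oc _] := O2; have [O'c _] := O'2.
  have [[Ol _] Or] := Oc; have [[O'l _] O'r] := O'c.
  split; first exact: (pinczon_cyclic nz2 b_deg0 b_sym b_nondeg dual_ee').
  case/lastP => [_|t y].
    by rewrite (pinczon_nil nz2 b_deg0 b_sym b_nondeg dual_ee') // mapof0 // B_0l.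
  rewrite size_rcons !ltnS leqn0 size_eq0 => /eqP->.
  rewrite (pinczon_rcons nz2 b_deg0 b_sym b_nondeg dual_ee') //.
  by have [_ ->] := multimaps_gbr (mm _ O2) (mm _ O'2); rewrite B_0l.
Qed.

Lemma Omega_isomorphism : graded_Lie_isomorphism (quadratic_maps G b)
  (multimap_degree G) (mbracket G) (cyclic_forms_ge2 G) (form_shifted_degree G)
  pinczon (Omega G b).
Proof.
split.
- by move=> a Q Q' _ _; apply: Omega_comb.
- split=> [Q [[Qp Q0] Qc]|Q Q'|O [[Op Oc] O0]].
  + split; first by split=> //; apply: Omega_polylinear.
    case/lastP => // t y; rewrite size_rcons !ltnS leqn0 size_eq0 => /eqP->.
    by rewrite Omega_rcons Q0 B_0l.
  + rewrite !inE => -[[[Ql _] _] _] [[[Q'l _] _] _] eqO.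
    rewrite -(map_of_Omega b_deg0 b_sym b_nondeg dual_ee' Ql) eqO.
    exact: map_of_Omega.
  + have [Ol _] := Op; exists (mapof O); last first.
      apply/funext => s; have [->|s0] := eqVneq s [::]; first by rewrite O0.
      exact: Omega_map_of_form.
    split; last exact: (map_of_form_cyclic b_deg0 b_sym dual_ee').
    split; first exact: (map_of_form_polylinear b_deg0 b_sym b_nondeg dual_ee').
    apply: (B_inj b_nondeg (G := G)) => w.
    by rewrite (map_of_formP b_deg0 b_sym dual_ee') // O0 // B_0l.
- rewrite multimap_degree_homog form_shifted_degree_homog => d Q _ Qd.
  exact: Omega_homog.
- by move=> Q Q' [Qm Qc] [Q'm Q'c]; rewrite mbracketE Omega_gbr.
Qed.

End Main.

Theorem proposition3p2 (K : fieldType) (charK : [pchar K]%R =i pred0)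
    (V : vectType K) (G : grading V) (b : {biscalar V}%R)
    (b_deg0 : form_of_degree0 G b)
    (b_sym : graded_symmetric G b)
    (b_nondeg : nondegenerate_form b)
    (n : nat) (e e' : n.-tuple V) (dual_ee' : dual_bases b e e') :
  graded_Lie_subalgebra (@multimaps K V) (multimap_degree G) (mbracket G)
    (quadratic_maps G b)
  /\
  [/\ graded_Lie_algebra (cyclic_forms G) (form_shifted_degree G)
        (pinczon_bracket G e e'),
      graded_Lie_subalgebra (cyclic_forms G) (form_shifted_degree G)
        (pinczon_bracket G e e') (cyclic_forms_ge2 G)
    & graded_Lie_isomorphism
        (quadratic_maps G b) (multimap_degree G) (mbracket G)
        (cyclic_forms_ge2 G) (form_shifted_degree G) (pinczon_bracket G e e')
        (Omega G b)].
Proof.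
have nz2 : (2%:R : K) != 0 by rewrite (proj1 (pcharf0P K) charK).
split; first exact: (quadratic_subalgebra nz2 b_deg0 b_sym b_nondeg dual_ee').
split; first exact: (cyclic_forms_Lie nz2 b_deg0 b_sym b_nondeg dual_ee').
  exact: (cyclic_forms_ge2_subalgebra nz2 b_deg0 b_sym b_nondeg dual_ee').
exact: (Omega_isomorphism nz2 b_deg0 b_sym b_nondeg dual_ee').
Qed.
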